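(* Let $Aut(\mathbb{S}^6,\omega)$ be the group of diffeomorphisms of $\mathbb{S}^6$ preserving the $2$-plectic form $\omega$. Then its identity component is $Aut(\mathbb{S}^6,\omega)^0=G_2$, where $G_2\subset SO(7,\mathbb{R})$ acts on $\mathbb{S}^6\subset\mathbb{R}^7$ by restriction of its linear action on $\mathbb{R}^7$.
   Context: The octonions $\mathbb{O}$ are the real algebra with vector space basis $e_0,e_1,\dots,e_7$, unit $e_0=1$, and products $e_ie_j=-\delta_{ij}+\sum_{k=1}^7\epsilon_{ijk}e_k$ for $i,j\in\{1,\dots,7\}$, where $\epsilon_{ijk}$ is completely antisymmetric, equal to $1$ for $ijk=123,145,167,246,275,374,365$, and $0$ whenever $(i,j,k)$ is not a permutation of one of these triples. The imaginary octonions (span of $e_1,\dots,e_7$) are identified with $\mathbb{R}^7$ with its standard scalar product $\langle\cdot,\cdot\rangle$. The cross product on $\mathbb{R}^7$ is $u\times v:=\frac12(u\cdot v-v\cdot u)$. The constant-coefficient $3$-form $\widetilde\omega$ on $\mathbb{R}^7$ is $\widetilde\omega(u,v,w)=\langle u\times v,w\rangle$. Let $j:\mathbb{S}^6\hookrightarrow\mathbb{R}^7$ be the inclusion of the unit sphere and $\omega:=j^*\widetilde\omega\in\Omega^3(\mathbb{S}^6)$. $G_2\subset GL(7,\mathbb{R})$ is the image of the group of $\mathbb{R}$-algebra automorphisms of $\mathbb{O}$ under restriction to the imaginary octonions $\mathbb{R}^7$; it is a closed subgroup of $SO(7,\mathbb{R})$ and preserves $\mathbb{S}^6$ and $\omega$.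 The diffeomorphism group carries its usual ($C^\infty$) topology. *)

(* Defs.v *)
From HB Require Import structures.
From mathcomp Require Import all_boot all_order all_algebra.
From mathcomp Require Import all_classical all_reals all_analysis.

Set Implicit Arguments.
Unset Strict Implicit.
Unset Printing Implicit Defensive.

Import Order.TTheory GRing.Theory Num.Theory.
Import numFieldNormedType.Exports.

Local Open Scope classical_set_scope.
Local Open Scope ring_scope.

Definition oct_triples : seq (nat * nat * nat) :=
  [:: (1, 2, 3); (1, 4, 5); (1, 6, 7); (2, 4, 6); (2, 7, 5); (3, 7, 4);
      (3, 6, 5)]%N.

(* The completely antisymmetric symbol equal to 1 on [oct_triples]: the even
   permutations of a triple are its rotations. *)
Definition oct_eps (i j k : nat) : int :=
  if [|| (i, j, k) \in oct_triples, (j, k, i) \in oct_triples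
       | (k, i, j) \in oct_triples] then 1
  else if [|| (j, i, k) \in oct_triples, (i, k, j) \in oct_triples
            | (k, j, i) \in oct_triples] then -1
  else 0.

Section Octonions.
Variable R : realType.

Local Notation octonion := 'rV[R]_8.

Definition oct_e (i : 'I_8) : octonion := delta_mx 0 i.

Definition oct_emul (i j : 'I_8) : octonion :=
  if i == 0 then oct_e j
  else if j == 0 then oct_e i
  else - ((i == j)%:R *: oct_e 0)
       + \sum_(k < 8 | k != 0) (oct_eps i j k)%:~R *: oct_e k.

Definition oct_mul (x y : octonion) : octonion :=
  \sum_(i < 8) \sum_(j < 8) (x 0 i * y 0 j) *: oct_emul i j.

(* The identification of R^7 with the imaginary octonions: the coordinate of
   index k : 'I_7 is the coefficient of e_(k+1). *)
Definition oct_of_imag (u : 'rV[R]_7) : octonion :=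
  row_mx (0 : 'rV[R]_1) u.

Definition imag_of_oct (x : octonion) : 'rV[R]_7 :=
  rsubmx (x : 'rV[R]_(1 + 7)).

Definition oct_automorphism (phi : {linear octonion -> octonion}) : Prop :=
  [/\ bijective phi, phi (oct_e 0) = oct_e 0
    & forall x y, phi (oct_mul x y) = oct_mul (phi x) (phi y)].

Definition G2 : set {linear 'rV[R]_7 -> 'rV[R]_7} :=
  [set g | exists2 phi : {linear octonion -> octonion}, oct_automorphism phi
         & forall u, phi (oct_of_imag u) = oct_of_imag (g u)].

(* [u . v - v . u] is imaginary, so [imag_of_oct] loses nothing here. *)
Definition cross (u v : 'rV[R]_7) : 'rV[R]_7 :=
  imag_of_oct (2^-1 *: (oct_mul (oct_of_imag u) (oct_of_imag v)
                        - oct_mul (oct_of_imag v) (oct_of_imag u))).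

Definition dot (u v : 'rV[R]_7) : R := \sum_(i < 7) u 0 i * v 0 i.

Definition omega_tilde (u v w : 'rV[R]_7) : R := dot (cross u v) w.

End Octonions.

Section Sphere.
Variable R : realType.
Local Notation V := 'rV[R]_7.

Definition sphere6 : Type := {x : V | dot x x == 1}.

Lemma sphere6_base_subproof :
  dot (delta_mx 0 0 : V) (delta_mx 0 0) == 1.
Proof.
rewrite /dot (bigD1 ord0) //= big1 ?addr0 ?mxE ?eqxx ?mulr1// => i i0.
by rewrite !mxE /= (negbTE i0) mul0r.
Qed.

Definition sphere6_base : sphere6 := exist (fun x : V => dot x x == 1) _ sphere6_base_subproof.

(* x / |x|, with a junk value at x = 0.  The norm of the normed module
   'rV[R]_7 is the sup norm, hence the explicit Euclidean norm. *)
Definition sphere6_proj (x : V) : sphere6 :=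
  insubd sphere6_base ((Num.sqrt (dot x x))^-1 *: x).

Fixpoint iter_derive (vs : seq V) (F : V -> V) : V -> V :=
  if vs is v :: vs' then 'D_v (iter_derive vs' F) else F.

(* For open U this says that F is C^oo on U: differentiability of all iterated
   derivatives gives their continuity. *)
Definition smooth_on (U : set V) (F : V -> V) : Prop :=
  forall (vs : seq V) (x : V), U x -> differentiable (iter_derive vs F) x.

Definition smooth (f : sphere6 -> sphere6) : Prop :=
  forall p : sphere6, exists (U : set V) (F : V -> V),
    [/\ open_nbhs (sval p) U, smooth_on U F
      & forall q : sphere6, U (sval q) -> F (sval q) = sval (f q)].

Definition diffeomorphism (f : sphere6 -> sphere6) : Prop :=
  exists g : sphere6 -> sphere6,
    [/\ cancel f g, cancel g f, smooth f & smooth g].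

(* The extension of f to R^7 \ {0} that is constant on rays; it is smooth
   there when f is smooth. *)
Definition radial_ext (f : sphere6 -> sphere6) (x : V) : V :=
  sval (f (sphere6_proj x)).

Definition tangent (p : sphere6) (u : V) : Prop := dot (sval p) u = 0.

(* On tangent vectors the derivative does not depend on the extension. *)
Definition tangent_map (f : sphere6 -> sphere6) (p : sphere6) (u : V) : V :=
  'D_u (radial_ext f) (sval p).

(* A 3-form on S^6 is represented by its values at p : sphere6 on vectors of
   R^7; only the values on vectors tangent at p are meaningful. *)
Definition form3 : Type := sphere6 -> V -> V -> V -> R.

Definition form3_eq (a b : form3) : Prop :=
  forall (p : sphere6) (u v w : V), tangent p u -> tangent p v ->
    tangent p w -> a p u v w = b p u v w.

Definition pullback (f : sphere6 -> sphere6) (a : form3) : form3 :=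
  fun p u v w =>
    a (f p) (tangent_map f p u) (tangent_map f p v) (tangent_map f p w).

(* j^* omega_tilde: the differential of the inclusion j is the inclusion of
   the tangent spaces in R^7. *)
Definition omega : form3 := fun _ u v w => omega_tilde u v w.

(* The C^oo topology: uniform convergence on the compact manifold S^6 of the
   derivatives of all orders, which are taken on the radial extensions.  It is
   meaningful on smooth maps, and only used on sets of smooth maps. *)
Definition all_derivatives (f : sphere6 -> sphere6) :
    {ptws seq V -> {uniform sphere6 -> V}} :=
  fun vs p => iter_derive vs (radial_ext f) (sval p).

Definition Cinfty_selfmap : topologicalType := initial_topology all_derivatives.

Definition Aut_omega : set Cinfty_selfmap :=
  [set f | diffeomorphism f /\ form3_eq (pullback f omega) omega].

Definition G2_action : set Cinfty_selfmap :=
  [set f | exists2 g, G2 g & forall p : sphere6, sval (f p) = g (sval p)].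

End Sphere.

(* Main.v *)
From HB Require Import structures.
From mathcomp Require Import all_boot all_order all_algebra.
From mathcomp Require Import all_classical all_reals all_analysis.
From mathcomp Require Import ring lra.
Require Import Defs.

Set Implicit Arguments.
Unset Strict Implicit.
Unset Printing Implicit Defensive.

Import Order.TTheory GRing.Theory Num.Theory.
Import numFieldNormedType.Exports.

Local Open Scope classical_set_scope.
Local Open Scope ring_scope.

(** Why the theorem is true.  At a point p of the sphere, J u = p × u is a
    complex structure on the tangent space T_p, and omega_p is the real part of
    a complex volume form for J.  The stronger statement proved here is that
    every smooth map f of the sphere with f^* omega = omega is the restriction
    of an element of G_2.  Conversely G_2 acts by such maps, so Aut(S^6, omega)
    is G_2, and it remains to see that G_2 is connected.

    Rigidity.  A complex line of T_p is the kernel of the form omega_p(u, ., .)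
    for any nonzero u on it, so the derivative A of f, which preserves omega,
    maps complex lines to complex lines and satisfies A J = s J A with s = 1 or
    s = -1 (omega_map_J).  The sign s is locally constant, so the relation can
    be differentiated once more.  Its antisymmetric part contains no second
    derivative: it says that A preserves, up to the sign s, the Nijenhuis tensor
    of J.  On the sphere this tensor is, up to a factor, the tangential part T
    of the cross product: the almost complex structure is as far from integrable
    as possible.  Since omega(u, v, w) = <T(u, v), w>, preserving both omega and
    T up to sign forces <z, w> = s <A z, A w>, hence s = 1 and f is an isometry
    (nijenhuis_isometry).

    The computation is done on R^7 minus the origin, for the extension Phi of f
    that is homogeneous of degree 1 (cone_ext): J is then given by the linear
    formula x × u, and the derivative of Phi is an isometry of the whole of R^7
    at every point.  The second derivative of such a map vanishes by the
    argument that makes the Christoffel symbols of a flat metric zero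
    (isometry_second_derivative0), so Phi is linear, and it commutes with the
    cross product.

    Connectedness.  An element of G_2 is determined by the images (a, b, c) of
    e_1, e_2, e_4, which form an orthonormal triple with c orthogonal to a × b;
    conversely every such basic triple occurs (frame_G2).  The condition on c
    for fixed a, b describes a 3-sphere, and it is symmetric in the three
    vectors; five rotations of one vector at a time join the standard triple to
    any other one (basic_triples_connected).  The resulting curves are
    continuous in the C^oo topology because all iterated derivatives of x / |x|
    are bounded on the sphere: they belong to the algebra generated by the
    coordinates and 1 / |x| (iter_derive_unitv_bounded, act_continuous). *)

(** * The octonion product in coordinates *)

Section Coordinates.
Variable R : realType.
Local Notation V := 'rV[R]_7.
Implicit Types (u v w x y : V) (a b : R).

(** Coordinates are indexed by nat rather than by 'I_7, so that after expansion
    only literals such as crd u 3 occur and polynomial identities between vectors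
    are left to ring. *)
Definition crd u (n : nat) : R := u 0 (inord n).

Lemma crdE u (i : 'I_7) : u 0 i = crd u i.
Proof. by rewrite /crd inord_val. Qed.

Lemma crd_inj u v : (forall n, (n < 7)%N -> crd u n = crd v n) -> u = v.
Proof. by move=> h; apply/rowP => i; rewrite !crdE h. Qed.

Lemma crdD u v n : crd (u + v) n = crd u n + crd v n.
Proof. by rewrite /crd mxE. Qed.
Lemma crdN u n : crd (- u) n = - crd u n.
Proof. by rewrite /crd mxE. Qed.
Lemma crdZ a u n : crd (a *: u) n = a * crd u n.
Proof. by rewrite /crd mxE. Qed.
Lemma crd0 n : crd 0 n = 0.
Proof. by rewrite /crd mxE. Qed.

Lemma dotE u v : dot u v =
  crd u 0 * crd v 0 + crd u 1 * crd v 1 + crd u 2 * crd v 2 + crd u 3 * crd v 3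
  + crd u 4 * crd v 4 + crd u 5 * crd v 5 + crd u 6 * crd v 6.
Proof.
rewrite /dot; under eq_bigr do rewrite !crdE.
by rewrite !big_ord_recr /= big_ord0 add0r /=.
Qed.

Definition ceps (i j k : nat) : R := (oct_eps i.+1 j.+1 k.+1)%:~R.

Lemma ceps_sym i j k : (i < 7)%N -> (j < 7)%N -> (k < 7)%N ->
  ceps j i k = - ceps i j k.
Proof.
have : all (fun i => all (fun j => all (fun k =>
    oct_eps j.+1 i.+1 k.+1 == - oct_eps i.+1 j.+1 k.+1)
    (iota 0 7)) (iota 0 7)) (iota 0 7) by vm_compute.
have mem n : (n < 7)%N -> n \in iota 0 7 by rewrite mem_iota.
move=> /allP h /mem/h/allP hi /mem/hi/allP hj /mem/hj/eqP.
by rewrite /ceps => ->; rewrite rmorphN.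
Qed.

Definition icross u v : V :=
  \row_(k < 7) \sum_(i < 7) \sum_(j < 7) crd u i * crd v j * ceps i j k.

Lemma oct_emul_imag (i j : 'I_7) :
  oct_emul R (rshift 1 i) (rshift 1 j) =
  row_mx (- (i == j)%:R)%:M (\row_k ceps i j k).
Proof.
have r0 (m : 'I_7) : (rshift 1 m == 0 :> 'I_8) = false by [].
rewrite /oct_emul !r0 (inj_eq (@rshift_inj 1 7)); apply/rowP => k; rewrite !mxE.
rewrite summxE /=; case: splitP => l kl; last first.
  rewrite (bigD1 k) /=; last by apply/eqP => /(congr1 val)/=; rewrite kl.
  rewrite !mxE !eqxx /= big1 => [|m /andP[_ mk]]; last first.
    by rewrite !mxE eq_sym (negbTE mk) andbF mulr0.
  have -> : (k == 0) = false by apply/eqP => /(congr1 val)/=; rewrite kl.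
  by rewrite !mulr0 oppr0 add0r mulr1 addr0 /ceps kl.
have -> : k = 0 by apply: val_inj; rewrite /= kl; case: l {kl} => -[].
rewrite big1 => [|m mk]; last by rewrite !mxE eq_sym (negbTE mk) andbF mulr0.
by rewrite !mxE ord1 !eqxx /= mulr1 addr0 mulr1n.
Qed.

(** The imaginary part of a product of imaginary octonions is already
    antisymmetric, and the real part symmetric; this is why halving the
    commutator in the definition of cross just deletes the real part. *)
Lemma oct_mul_imag u v :
  oct_mul (oct_of_imag u) (oct_of_imag v) = row_mx (- dot u v)%:M (icross u v).
Proof.
have rl (i : 'I_7) : oct_of_imag u 0 (rshift 1 i) = u 0 i
  by rewrite (@row_mxEr _ _ 1 7).
have rl' (i : 'I_7) : oct_of_imag v 0 (rshift 1 i) = v 0 i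
  by rewrite (@row_mxEr _ _ 1 7).
have l0 w : oct_of_imag w 0 (lshift 7 (0 : 'I_1)) = 0.
  by rewrite (@row_mxEl _ _ 1 7) mxE.
rewrite /oct_mul (@big_split_ord _ _ _ 1 7) /= big_ord1 big1 ?add0r; last first.
  by move=> j _; rewrite l0 mul0r scale0r.
under eq_bigr => i _.
  rewrite (@big_split_ord _ _ _ 1 7) /= big_ord1 l0 mulr0 scale0r add0r.
  under eq_bigr => j _ do rewrite rl rl' oct_emul_imag.
  over.
apply/rowP => k; rewrite summxE; under eq_bigr do rewrite summxE.
rewrite mxE; case: splitP => l kl.
  rewrite ord1 mxE /dot mulr1n -sumrN; apply: eq_bigr => i _.
  rewrite (bigD1 i) //= big1 => [|j ji]; rewrite !mxE; case: splitP => m km.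
  - by rewrite ord1 !mxE !eqxx addr0 mulr1n mulrN mulr1.
  - by move: kl km (ltn_ord l); case: (l : nat) => // ->.
  - by rewrite !mxE eq_sym (negbTE ji) oppr0 mul0rn mulr0.
  - by move: kl km (ltn_ord l); case: (l : nat) => // ->.
rewrite !mxE; apply: eq_bigr => i _; apply: eq_bigr => j _; rewrite !mxE.
case: splitP => m km; first by move: km (ltn_ord m); rewrite kl; case: (m: nat).
by rewrite !mxE !crdE (_ : l = m)//; apply: val_inj; move: km; rewrite kl => -[].
Qed.

Lemma icross_sym u v : icross v u = - icross u v.
Proof.
apply/rowP => k; rewrite !mxE exchange_big /= -sumrN; apply: eq_bigr => i _.
rewrite -sumrN; apply: eq_bigr => j _; rewrite ceps_sym //; ring.
Qed.

Lemma dotC u v : dot u v = dot v u.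
Proof. by apply: eq_bigr => i _; rewrite mulrC. Qed.

Lemma cross_icross u v : cross u v = icross u v.
Proof.
rewrite /cross !oct_mul_imag (icross_sym u v) dotC.
rewrite (@opp_row_mx _ _ 1 7) (@add_row_mx _ _ 1 7) (@scale_row_mx _ _ 1 7).
rewrite /imag_of_oct (@row_mxKr _ _ 1 7) opprK -mulr2n.
rewrite -[icross u v *+ 2]scaler_nat scalerA.
by rewrite mulVf ?pnatr_eq0 // scale1r.
Qed.

Lemma oct_mul_imagE u v : oct_mul (oct_of_imag u) (oct_of_imag v) =
  row_mx (- dot u v)%:M (cross u v).
Proof. by rewrite cross_icross oct_mul_imag. Qed.

(** One component for each point of the Fano plane, with the three oriented lines
    through it.  The seven equations are grouped in a product of products so that
    the lemma serves as a multirule for rewriting. *)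
Lemma crd_cross u v :
  ((crd (cross u v) 0 = crd u 1 * crd v 2 - crd u 2 * crd v 1
    + crd u 3 * crd v 4 - crd u 4 * crd v 3
    + crd u 5 * crd v 6 - crd u 6 * crd v 5) *
   (crd (cross u v) 1 = crd u 2 * crd v 0 - crd u 0 * crd v 2
    + crd u 3 * crd v 5 - crd u 5 * crd v 3
    + crd u 6 * crd v 4 - crd u 4 * crd v 6)) *
  ((crd (cross u v) 2 = crd u 0 * crd v 1 - crd u 1 * crd v 0
    + crd u 6 * crd v 3 - crd u 3 * crd v 6
    + crd u 5 * crd v 4 - crd u 4 * crd v 5) *
   (crd (cross u v) 3 = crd u 4 * crd v 0 - crd u 0 * crd v 4
    + crd u 5 * crd v 1 - crd u 1 * crd v 5
    + crd u 2 * crd v 6 - crd u 6 * crd v 2) *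
   (crd (cross u v) 4 = crd u 0 * crd v 3 - crd u 3 * crd v 0
    + crd u 1 * crd v 6 - crd u 6 * crd v 1
    + crd u 2 * crd v 5 - crd u 5 * crd v 2) *
   (crd (cross u v) 5 = crd u 6 * crd v 0 - crd u 0 * crd v 6
    + crd u 1 * crd v 3 - crd u 3 * crd v 1
    + crd u 4 * crd v 2 - crd u 2 * crd v 4) *
   (crd (cross u v) 6 = crd u 0 * crd v 5 - crd u 5 * crd v 0
    + crd u 4 * crd v 1 - crd u 1 * crd v 4
    + crd u 3 * crd v 2 - crd u 2 * crd v 3)).
Proof.
have E k : (k < 7)%N -> crd (cross u v) k = \sum_(i < 7) \sum_(j < 7)
    crd u i * crd v j * ceps i j k.
  by move=> hk; rewrite /crd cross_icross mxE inordK.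
do ?split; rewrite E // !big_ord_recr /= !big_ord0 /=;
  rewrite /ceps /oct_eps /=; ring.
Qed.
End Coordinates.

(** Locked versions of dot and cross.  Comparing two cross products by conversion
    would unfold the whole multiplication table of the octonions. *)
HB.lock Definition vdot (R : realType) (u v : 'rV[R]_7) : R := dot u v.
HB.lock Definition vcross (R : realType) (u v : 'rV[R]_7) : 'rV[R]_7 := cross u v.

Section LockedOperations.
Variable R : realType.
Implicit Types (u v w : 'rV[R]_7).
Lemma vdotE u v : vdot u v =
  crd u 0 * crd v 0 + crd u 1 * crd v 1 + crd u 2 * crd v 2 + crd u 3 * crd v 3
  + crd u 4 * crd v 4 + crd u 5 * crd v 5 + crd u 6 * crd v 6.
Proof. by rewrite vdot.unlock dotE. Qed.
Lemma vdotC u v : vdot u v = vdot v u.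
Proof. by rewrite !vdotE; ring. Qed.

Lemma dot_vdot u v : dot u v = vdot u v.
Proof. by rewrite vdot.unlock. Qed.

Lemma omega_vdot u v w : omega_tilde u v w = vdot (vcross u v) w.
Proof. by rewrite vdot.unlock vcross.unlock. Qed.

End LockedOperations.

(** * Identities of the cross product *)

Section CrossProduct.
Variable R : realType.
Local Notation V := 'rV[R]_7.
Implicit Types (u v w x y z : V) (a b : R).

Ltac by_crd := apply: crd_inj; case=> [|[|[|[|[|[|[|//]]]]]]] _;
  rewrite ?vcross.unlock ?(crd_cross, crdD, crdN, crdZ, crd0, vdotE); ring.

Lemma dotDl u v w : vdot (u + v) w = vdot u w + vdot v w.
Proof. by rewrite !vdotE !crdD; ring. Qed.
Lemma dotZl a u v : vdot (a *: u) v = a * vdot u v.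
Proof. by rewrite !vdotE !crdZ; ring. Qed.
Lemma dotNl u v : vdot (- u) v = - vdot u v.
Proof. by rewrite !vdotE !crdN; ring. Qed.
Lemma dotBl u v w : vdot (u - v) w = vdot u w - vdot v w.
Proof. by rewrite dotDl dotNl. Qed.
Lemma dotDr u v w : vdot w (u + v) = vdot w u + vdot w v.
Proof. by rewrite vdotC dotDl !(vdotC _ w). Qed.
Lemma dotZr a u v : vdot v (a *: u) = a * vdot v u.
Proof. by rewrite vdotC dotZl vdotC. Qed.
Lemma dotNr u v : vdot v (- u) = - vdot v u.
Proof. by rewrite vdotC dotNl vdotC. Qed.
Lemma dotBr u v w : vdot w (u - v) = vdot w u - vdot w v.
Proof. by rewrite dotDr dotNr. Qed.
Lemma dot0l u : vdot 0 u = 0.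
Proof. by rewrite -(scale0r u) dotZl mul0r. Qed.
Lemma dot0r u : vdot u 0 = 0.
Proof. by rewrite vdotC dot0l. Qed.

Lemma dot_ge0 u : 0 <= vdot u u.
Proof. by rewrite vdot.unlock; apply: sumr_ge0 => i _; rewrite -expr2 sqr_ge0. Qed.

Lemma dot_eq0 u : (vdot u u == 0) = (u == 0).
Proof.
apply/eqP/eqP => [|->]; last by rewrite dot0l.
move/eqP; rewrite vdot.unlock psumr_eq0 => [/allP h|i _]; last by rewrite -expr2 sqr_ge0.
apply/rowP => i; rewrite mxE; apply/eqP.
by have := h i (mem_index_enum _); rewrite /= mulf_eq0 orbb.
Qed.

Lemma dot_gt0 u : (0 < vdot u u) = (u != 0).
Proof. by rewrite lt_neqAle dot_ge0 andbT eq_sym dot_eq0. Qed.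

Lemma crossC u v : vcross v u = - vcross u v.
Proof. by_crd. Qed.
Lemma crossDr u v w : vcross u (v + w) = vcross u v + vcross u w.
Proof. by_crd. Qed.
Lemma crossZr a u v : vcross u (a *: v) = a *: vcross u v.
Proof. by_crd. Qed.
Lemma crossNr u v : vcross u (- v) = - vcross u v.
Proof. by rewrite -scaleN1r crossZr scaleN1r. Qed.
Lemma crossBr u v w : vcross u (v - w) = vcross u v - vcross u w.
Proof. by rewrite crossDr crossNr. Qed.
Lemma cross0r u : vcross u 0 = 0.
Proof. by rewrite -(scale0r u) crossZr !scale0r. Qed.
Lemma crossDl u v w : vcross (v + w) u = vcross v u + vcross w u.
Proof. by rewrite crossC crossDr opprD -!crossC. Qed.
Lemma crossZl a u v : vcross (a *: v) u = a *: vcross v u.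
Proof. by rewrite crossC crossZr -scalerN -crossC. Qed.
Lemma cross0l u : vcross 0 u = 0.
Proof. by rewrite crossC cross0r oppr0. Qed.

Lemma crossxx u : vcross u u = 0.
Proof. by_crd. Qed.

(** Alternativity of the octonions, x (x u) = (x x) u, restricted to imaginary
    elements.  Together with bilinearity and triple_cyc it implies all further
    properties of the cross product. *)
Lemma cross_cross x u : vcross x (vcross x u) = vdot x u *: x - vdot x x *: u.
Proof. by_crd. Qed.

Lemma triple_cyc u v w : vdot (vcross u v) w = vdot (vcross v w) u.
Proof. by rewrite !vcross.unlock !vdotE !crd_cross; ring. Qed.

Lemma cross_polar x v u : vcross x (vcross v u) + vcross v (vcross x u) =
  vdot x u *: v + vdot v u *: x - (2 * vdot x v) *: u.
Proof.
have := cross_cross (x + v) u; rewrite !(crossDl, crossDr, dotDl, dotDr).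
rewrite !cross_cross (vdotC v x) => /eqP; rewrite -subr_eq0 => /eqP h.
apply/eqP; rewrite -subr_eq0 -h; apply/eqP; move: (vcross x _) (vcross v _) => p q.
by apply/rowP => i; rewrite !mxE; ring.
Qed.

Lemma triple0 u v : vdot (vcross u v) v = 0.
Proof. by rewrite triple_cyc crossxx dot0l. Qed.
Lemma triple0' u v : vdot (vcross u v) u = 0.
Proof. by rewrite crossC dotNl triple0 oppr0. Qed.
Lemma dot_crossr u v w : vdot u (vcross v w) = vdot (vcross u v) w.
Proof. by rewrite vdotC -triple_cyc. Qed.

(** Lagrange's identity; left multiplication by a unit x is an isometry of the
    orthogonal complement of x. *)
Lemma dot_cross_cross x u v :
  vdot (vcross x u) (vcross x v) = vdot x x * vdot u v - vdot x u * vdot x v.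
Proof.
rewrite vdotC dot_crossr crossC dotNl cross_cross dotBl !dotZl (vdotC v u).
ring.
Qed.

(** Fewer than seven linear equations on R^7 have a nonzero solution. *)
Lemma exists_perp (s : seq V) : (size s < 7)%N ->
  exists2 w, vdot w w = 1 & forall x, x \in s -> vdot x w = 0.
Proof.
move=> ss; pose M : 'M[R]_(7, size s) := \matrix_(i, j) (nth 0 s j) 0 i.
have : kermx M != 0.
  rewrite -mxrank_eq0 mxrank_ker subn_eq0 -ltnNge.
  by apply: leq_ltn_trans ss; exact: rank_leq_col.
move=> /rowV0Pn[w /sub_kermxP wM w0].
have dw : 0 < vdot w w by rewrite dot_gt0.
exists ((Num.sqrt (vdot w w))^-1 *: w) => [|x xs].
  rewrite dotZl dotZr mulrA -invfM -expr2 sqr_sqrtr ?dot_ge0 //.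
  by rewrite mulVf // gt_eqF.
rewrite dotZr; suff -> : vdot x w = 0 by rewrite mulr0.
have/matrixP/(_ 0 (Ordinal (etrans (index_mem x s) xs)))/= := wM.
rewrite !mxE vdot.unlock => h; rewrite -[RHS]h; apply: eq_bigr => i _.
by rewrite mxE /= nth_index // mulrC.
Qed.

End CrossProduct.

(** * The special complex structure of a tangent space *)

(** For a unit vector x, the tangential part of the cross product.  It is
    conjugate-linear in both arguments for J = x × _, it represents omega at x
    (tcross_omega), and it is the Nijenhuis tensor of J up to a constant factor
    (tcross_JJ).  Locked for the same reason as vcross. *)
HB.lock Definition tcross (R : realType) (x u v : 'rV[R]_7) : 'rV[R]_7 :=
  vcross u v - vdot x (vcross u v) *: x.

Section TangentGeometry.
Variable R : realType.
Local Notation V := 'rV[R]_7.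
Implicit Types (u v w x y z : V) (a b : R).

Lemma tcrossDr x u v w : tcross x u (v + w) = tcross x u v + tcross x u w.
Proof. by rewrite tcross.unlock crossDr dotDr scalerDl opprD addrACA. Qed.
Lemma tcrossZr x u v a : tcross x u (a *: v) = a *: tcross x u v.
Proof. by rewrite tcross.unlock crossZr dotZr scalerBr scalerA. Qed.
Lemma tcrossC x u v : tcross x v u = - tcross x u v.
Proof. by rewrite tcross.unlock (crossC u v) dotNr scaleNr opprB opprK addrC. Qed.
Lemma tcrossDl x u v w : tcross x (v + w) u = tcross x v u + tcross x w u.
Proof. by rewrite tcrossC tcrossDr opprD -!tcrossC. Qed.
Lemma tcrossZl x u v a : tcross x (a *: v) u = a *: tcross x v u.
Proof. by rewrite tcrossC tcrossZr -scalerN -tcrossC. Qed.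

Lemma tcross0r x u : tcross x u 0 = 0.
Proof. by rewrite tcross.unlock cross0r dot0r scale0r subr0. Qed.
Lemma tcross0l x u : tcross x 0 u = 0.
Proof. by rewrite tcrossC tcross0r oppr0. Qed.

Section AtPoint.
Variable x : V.
Hypothesis x1 : vdot x x = 1.

Lemma dot_tcross u v : vdot x (tcross x u v) = 0.
Proof. by rewrite tcross.unlock dotBr dotZr x1 mulr1 subrr. Qed.

Lemma dot_J u : vdot x (vcross x u) = 0.
Proof. by rewrite vdotC triple0'. Qed.

Lemma tangent_split u : exists2 u', vdot x u' = 0 & u = vdot x u *: x + u'.
Proof.
exists (u - vdot x u *: x); first by rewrite dotBr dotZr x1 mulr1 subrr.
by rewrite addrC subrK.
Qed.

Lemma tcross_omega u v w : vdot x w = 0 ->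
  vdot (tcross x u v) w = vdot (vcross u v) w.
Proof. by move=> xw; rewrite tcross.unlock dotBl dotZl xw mulr0 subr0. Qed.

Lemma J_square u : vdot x u = 0 -> vcross x (vcross x u) = - u.
Proof. by move=> xu; rewrite cross_cross xu x1 scale0r add0r scale1r. Qed.

Lemma cross_J u v : vdot x u = 0 -> vdot x v = 0 ->
  vcross (vcross x u) v = - vcross x (vcross u v) - vdot u v *: x.
Proof.
move=> xu xv; have := cross_polar v x u.
rewrite (vdotC v x) xu xv mulr0 !scale0r !(add0r, addr0, subr0, oppr0).
move=> h; rewrite crossC -[vcross v _](addrK (vcross x (vcross v u))) h.
by rewrite (crossC u v) crossNr opprB (vdotC v u).
Qed.

Lemma tcross_J u v : vdot x u = 0 -> vdot x v = 0 ->
  tcross x (vcross x u) v = - vcross x (tcross x u v).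
Proof.
move=> xu xv; rewrite {1}tcross.unlock cross_J // dotBr dotNr dot_J dotZr x1.
rewrite tcross.unlock crossBr crossZr crossxx scaler0 subr0 oppr0 sub0r mulr1.
by rewrite scaleNr opprK subrK.
Qed.

Lemma tcross_Jr u v : vdot x u = 0 -> vdot x v = 0 ->
  tcross x u (vcross x v) = tcross x (vcross x u) v.
Proof.
by move=> xu xv; rewrite tcrossC !tcross_J // opprK tcrossC crossNr.
Qed.

Lemma tcross_self_J u : vdot x u = 0 -> tcross x u (vcross x u) = 0.
Proof.
move=> xu; rewrite tcross_Jr // tcross_J //.
by rewrite tcross.unlock crossxx dot0r scale0r subr0 cross0r oppr0.
Qed.

Lemma dot_tcross_tcross u v : vdot (tcross x u v) (tcross x u v) =
  vdot u u * vdot v v - vdot u v ^+ 2 - vdot (vcross x u) v ^+ 2.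
Proof.
rewrite tcross.unlock dotBl !dotBr !dotZl !dotZr x1 dot_cross_cross.
rewrite (vdotC _ x) dot_crossr; ring.
Qed.

(** The left-hand side is what remains of the derivative of the relation
    A J = s J A after antisymmetrisation: the radial parts cancel because
    <u × v, x> is J-invariant, and the tangential parts add up because tcross is
    conjugate-linear in both arguments. *)
Lemma tcross_JJ u v : vdot x u = 0 -> vdot x v = 0 ->
  vcross v u - vcross (vcross x v) (vcross x u) = 2 *: tcross x v u.
Proof.
move=> xu xv; rewrite cross_J ?dot_J //.
have -> : vcross v (vcross x u) = - vcross x (vcross v u) + vdot u v *: x.
  rewrite crossC cross_J // opprB opprK addrC (crossC v u) crossNr.
  by rewrite addrC.
rewrite crossDr crossZr crossxx scaler0 addr0 crossNr opprK cross_cross x1.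
rewrite scale1r (dot_crossr v) (crossC x v) dotNl -dot_crossr tcross.unlock.
by apply/rowP => i; rewrite !mxE; ring.
Qed.

(** Any unit v orthogonal to the complex line of z works: left multiplication by
    v squares to -1 on z. *)
Lemma tcross_surj z : vdot x z = 0 -> exists v u,
  [/\ vdot x v = 0, vdot x u = 0 & tcross x v u = z].
Proof.
move=> xz; have [v v1 h] := @exists_perp _ [:: x; z; vcross x z] isT.
have xv : vdot x v = 0 by rewrite h // !inE eqxx ?orbT.
have zv : vdot z v = 0 by rewrite h // !inE eqxx ?orbT.
have Jv : vdot (vcross x z) v = 0 by rewrite h // !inE eqxx ?orbT.
have hvz : vdot x (vcross v z) = 0.
  by rewrite (crossC z v) dotNr vdotC -triple_cyc Jv oppr0.
exists v, (- vcross v z); split=> //; first by rewrite dotNr hvz oppr0.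
rewrite tcross.unlock crossNr cross_cross v1 (vdotC v z) zv scale0r add0r scale1r.
by rewrite opprK xz scale0r subr0.
Qed.

Lemma tcross_nondeg u : vdot x u = 0 -> u != 0 ->
  exists2 v, vdot x v = 0 & tcross x u v != 0.
Proof.
move=> xu u0; have [v v1 h] := @exists_perp _ [:: x; u; vcross x u] isT.
have xv : vdot x v = 0 by rewrite h // !inE eqxx ?orbT.
exists v => //; rewrite -dot_eq0 dot_tcross_tcross v1 !h ?inE ?eqxx ?orbT //.
by rewrite expr0n !subr0 mulr1 dot_eq0.
Qed.

Lemma J_independent u a b : vdot x u = 0 -> a *: u + b *: vcross x u = 0 -> u != 0 ->
  a = 0 /\ b = 0.
Proof.
move=> xu h; rewrite -dot_eq0 => u0.
have ju : vdot u (vcross x u) = 0 by rewrite vdotC triple0.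
have := congr1 (vdot u) h; rewrite dotDr !dotZr ju mulr0 addr0 dot0r.
move=> /eqP; rewrite mulf_eq0 (negbTE u0) orbF => /eqP a0; split=> //.
have := congr1 (vdot (vcross x u)) h; rewrite dotDr !dotZr (vdotC _ u) ju mulr0.
rewrite add0r dot0r dot_cross_cross x1 xu mul1r mul0r subr0.
by move=> /eqP; rewrite mulf_eq0 (negbTE u0) orbF => /eqP.
Qed.

End AtPoint.

(** By dot_tcross_tcross, vanishing of tcross x u v is the equality case of
    Bessel's inequality for v and the orthogonal pair u, J u. *)
Lemma J_line x u v : vdot x x = 1 -> vdot x u = 0 -> vdot x v = 0 -> u != 0 ->
  tcross x u v = 0 -> exists a b, v = a *: u + b *: vcross x u.
Proof.
move=> x1 xu xv; rewrite -dot_gt0 => u0 T0.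
have := dot_tcross_tcross x1 u v; rewrite T0 dot0l => h.
exists (vdot u v / vdot u u), (vdot (vcross x u) v / vdot u u).
apply/eqP; rewrite -subr_eq0 -dot_eq0.
have ju : vdot u (vcross x u) = 0 by rewrite vdotC triple0.
have jj : vdot (vcross x u) (vcross x u) = vdot u u.
  by rewrite dot_cross_cross x1 xu mul1r mul0r subr0.
rewrite !(dotBl, dotBr, dotDl, dotDr, dotZl, dotZr) (vdotC v u).
rewrite (vdotC v (vcross x u)) (vdotC (vcross x u) u) ju jj.
move: h u0; move: (vdot u u) (vdot v v) (vdot u v) (vdot (vcross x u) v) => p q r s.
move=> h p0; have p0' : p != 0 by rewrite gt_eqF.
apply/eqP; transitivity ((p * q - r ^+ 2 - s ^+ 2) / p); first by field.
by rewrite -h mul0r.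
Qed.

Lemma lin_inj_surj (A : {linear V -> V}) : (forall u, A u = 0 -> u = 0) ->
  forall w, exists u, A u = w.
Proof.
move=> injA w; have : row_free (lin1_mx A).
  rewrite -kermx_eq0; apply/eqP/row_matrixP => i; rewrite row0.
  apply: injA; rewrite -mul_rV_lin1; apply/sub_kermxP.
  exact: row_sub.
rewrite row_free_unit => fA; exists (w *m invmx (lin1_mx A)).
by rewrite -mul_rV_lin1 mulmxKV.
Qed.

(** What is known pointwise about the derivative at x of the homogeneous extension
    of a map preserving omega. *)
Definition tangent_omega_map (A : {linear V -> V}) x y : Prop :=
  [/\ vdot x x = 1, vdot y y = 1, A x = y,
      forall u, vdot x u = 0 -> vdot y (A u) = 0 &
      forall u v w, vdot x u = 0 -> vdot x v = 0 -> vdot x w = 0 ->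
        vdot (vcross (A u) (A v)) (A w) = vdot (vcross u v) w].

Section OmegaMap.
Variables (A : {linear V -> V}) (x y : V).
Hypothesis omA : tangent_omega_map A x y.

Let x1 : vdot x x = 1. Proof. by case: omA. Qed.
Let y1 : vdot y y = 1. Proof. by case: omA. Qed.
Let Ax : A x = y. Proof. by case: omA. Qed.
Let tA u : vdot x u = 0 -> vdot y (A u) = 0.
Proof. by case: omA => _ _ _ h _; exact: h. Qed.
Let oA u v w : vdot x u = 0 -> vdot x v = 0 -> vdot x w = 0 ->
  vdot (vcross (A u) (A v)) (A w) = vdot (vcross u v) w.
Proof. by case: omA => _ _ _ _ h; exact: h. Qed.

Lemma omega_map_tcross u v w : vdot x u = 0 -> vdot x v = 0 -> vdot x w = 0 ->
  vdot (tcross y (A u) (A v)) (A w) = vdot (tcross x u v) w.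
Proof. by move=> xu xv xw; rewrite !tcross_omega ?tA ?oA. Qed.

Lemma omega_map_inj u : A u = 0 -> u = 0.
Proof.
have [u' xu' ->] := tangent_split x1 u; rewrite linearD linearZ /= Ax => h.
have := congr1 (vdot y) h; rewrite dotDr dotZr y1 tA // mulr1 addr0 dot0r.
move=> xu; move: h; rewrite xu !scale0r !add0r => Au.
apply/eqP/contraT => u0; have [v xv T0] := tcross_nondeg x1 xu' u0.
have := omega_map_tcross xu' xv (dot_tcross x1 u' v).
rewrite Au tcross0l dot0l => /esym/eqP.
by rewrite dot_eq0 (negbTE T0).
Qed.

Lemma omega_map_surj w : exists u, A u = w.
Proof. exact: lin_inj_surj omega_map_inj w. Qed.

Lemma omega_map_surjt w : vdot y w = 0 -> exists2 u, vdot x u = 0 & A u = w.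
Proof.
have [u <-] := omega_map_surj w; have [u' xu' ->] := tangent_split x1 u.
rewrite linearD linearZ /= Ax dotDr dotZr y1 tA // mulr1 addr0 => ->.
by exists u'; rewrite // scale0r add0r.
Qed.

(** Complex lines are kernels of omega, so A J u = a A u + b J A u for each u.
    The pair (a, b) is the same for u and v whenever tcross x u v is nonzero,
    because omega(J u, v, .) = omega(u, J v, .); since the vectors v admitting
    the pair (a, b) of a fixed u form a linear subspace, and those with
    tcross x u v nonzero span the tangent space, it is the same for all v.
    Applying J twice gives (a + b J)^2 = -1, that is a = 0 and b^2 = 1. *)
Lemma omega_map_J : exists2 s, s ^+ 2 = 1 :> R &
  forall u, A (vcross x u) = s *: vcross y (A u).
Proof.
have eqT p q : vdot y p = 0 -> vdot y q = 0 ->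
    (forall w, vdot x w = 0 -> vdot p (A w) = vdot q (A w)) -> p = q.
  move=> yp yq h; apply/eqP; rewrite -subr_eq0 -dot_eq0.
  have [|w xw Aw] := @omega_map_surjt (p - q); first by rewrite dotBr yp yq subr0.
  by rewrite -{2}Aw dotBl h // subrr.
have [u u1 hu] := @exists_perp _ [:: x] isT.
have xu : vdot x u = 0 by rewrite hu // inE.
have u0 : u != 0 by rewrite -dot_eq0 u1 oner_eq0.
have Au0 : A u != 0 by apply: contraNneq u0 => /omega_map_inj ->.
have [a [b AJ]] : exists a b, A (vcross x u) = a *: A u + b *: vcross y (A u).
  apply: J_line; rewrite ?tA ?dot_J //.
  apply: eqT => [||w xw]; [exact: dot_tcross|exact: dot0r|].
  by rewrite omega_map_tcross ?dot_J // tcross_self_J // !dot0l.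
have W v : vdot x v = 0 -> A (vcross x v) = a *: A v + b *: vcross y (A v).
  have W1 v' : vdot x v' = 0 -> tcross x u v' != 0 ->
      A (vcross x v') = a *: A v' + b *: vcross y (A v').
    move=> xv T0.
    (* tcross y (A u) (A v') is nonzero, so it detects equality of the pairs. *)
    have T0' : tcross y (A u) (A v') != 0.
      apply: contraNneq T0 => h; rewrite -dot_eq0.
      by rewrite -(@omega_map_tcross u v') ?dot_tcross // h dot0l.
    have eT : tcross y (A u) (A (vcross x v')) = tcross y (A (vcross x u)) (A v').
      apply: eqT => [||w xw]; try exact: dot_tcross.
      rewrite (omega_map_tcross xu (dot_J x v') xw).
      by rewrite (omega_map_tcross (dot_J x u) xv xw) tcross_Jr.
    have [||||c [d AJv]] := @J_line y (A v') (A (vcross x v')) y1.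
    - exact: tA.
    - by rewrite tA // dot_J.
    - by apply: contraNneq T0' => ->; rewrite tcross0r.
    - apply: eqT => [||w xw]; [exact: dot_tcross|exact: dot0r|].
      by rewrite omega_map_tcross ?dot_J // tcross_self_J // !dot0l.
    move: eT; rewrite AJ AJv tcrossDl tcrossDr !(tcrossZl, tcrossZr).
    rewrite tcross_Jr ?tA // tcross_J ?tA // => /eqP; rewrite -subr_eq0 => /eqP eT.
    have [|||ca db] := @J_independent y y1 (tcross y (A u) (A v')) (c - a) (b - d).
    - exact: dot_tcross.
    - by rewrite -[RHS]eT; apply/rowP => i; rewrite !mxE; ring.
    - by [].
    by move/eqP: ca; move/eqP: db; rewrite !subr_eq0 => /eqP -> /eqP ->.
  move=> xv; have [T0|] := eqVneq (tcross x u v) 0; last exact: W1.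
  have [w xw Tw] := tcross_nondeg x1 xu u0.
  have := W1 (v + w); rewrite dotDr xv xw addr0 tcrossDr T0 add0r => /(_ erefl Tw).
  rewrite crossDr !(linearD A) crossDr (W1 w) // !scalerDr [X in _ = X]addrACA.
  exact: addIr.
have := W _ (dot_J x u); rewrite J_square // linearN /= AJ crossDr !crossZr J_square ?tA //.
move=> /eqP; rewrite -subr_eq0 opprD => h.
have [|||h1 h2] := @J_independent y y1 (A u) (a ^+ 2 - b ^+ 2 + 1) (2 * a * b).
- exact: tA.
- apply/eqP; rewrite -oppr_eq0; move: h; congr (_ == 0).
  by apply/rowP => i; rewrite !mxE; ring.
- by [].
have b0 : b != 0.
  apply/eqP => b0; move: h1; rewrite b0 expr0n subr0 => /eqP.
  by rewrite gt_eqF // ltr_wpDl ?ltr01 ?sqr_ge0.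
have a0 : a = 0.
  by move/eqP: h2; rewrite !mulf_eq0 pnatr_eq0 (negbTE b0) orbF => /eqP.
exists b.
  by move/eqP: h1; rewrite a0 expr0n add0r addrC subr_eq0 => /eqP <-.
move=> v; have [v' xv' ->] := tangent_split x1 v; rewrite crossDr crossZr crossxx scaler0.
rewrite add0r linearD linearZ /= Ax crossDr crossZr crossxx scaler0 add0r.
by rewrite W // a0 scale0r add0r.
Qed.

End OmegaMap.
End TangentGeometry.

(** * Integrability obstruction and isometries *)

Section AlmostComplex.
Variable R : realType.
Local Notation V := 'rV[R]_7.
Implicit Types (u v w x y z : V) (a b : R).

(** B stands for the second derivative, and the last hypothesis for the derivative
    of A J = s J A with s constant.  Antisymmetrised in u and v, and subtracted
    from the same expression at J u and J v, it loses all terms in B by symmetry;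
    tcross_JJ turns the rest into A (tcross x v u) = s tcross y (A v) (A u).
    Comparing with the invariance of omega gives <z, w> = s <A z, A w> on tangent
    vectors, and z = w excludes s = -1. *)
Lemma nijenhuis_isometry (A : {linear V -> V}) x y (B : V -> V -> V) (s : R) :
  tangent_omega_map A x y ->
  s ^+ 2 = 1 -> (forall u, A (vcross x u) = s *: vcross y (A u)) ->
  (forall u v, B u v = B v u) -> (forall u v, B u (- v) = - B u v) ->
  (forall v u, B v (vcross x u) + A (vcross v u) =
     s *: (vcross (A v) (A u) + vcross y (B v u))) ->
  s = 1 /\ forall u v, vdot (A u) (A v) = vdot u v.
Proof.
move=> [x1 y1 Ax tA oA] s2 AJ BC BN E.
have half v u : vdot x u = 0 -> vdot x v = 0 ->
    A (tcross x v u) = s *: tcross y (A v) (A u).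
  move=> xu xv.
  have E1 := E v u; have E2 := E u v.
  have E3 := E (vcross x v) (vcross x u); have E4 := E (vcross x u) (vcross x v).
  move: E3 E4; rewrite !J_square // !BN !AJ => E3 E4.
  have key : A (2 *: tcross x v u) = s *: (2 *: tcross y (A v) (A u)).
    rewrite -!tcross_JJ ?tA // linearB.
    have ss : vcross (s *: vcross y (A v)) (s *: vcross y (A u)) =
        vcross (vcross y (A v)) (vcross y (A u)).
      by rewrite crossZl crossZr scalerA -expr2 s2 scale1r.
    have ss' : vcross (s *: vcross y (A u)) (s *: vcross y (A v)) =
        - vcross (vcross y (A v)) (vcross y (A u)).
      by rewrite crossZl crossZr scalerA -expr2 s2 scale1r crossC.
    move: E2; rewrite (crossC v u) linearN /= => E2.
    move: E4; rewrite (crossC (vcross x v)) linearN /= => E4.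
    rewrite ss in E3; rewrite ss' in E4.
    rewrite (crossC (A v) (A u)) in E2.
    rewrite (BC u v) in E2; rewrite (BC (vcross x v) u) in E3.
    rewrite (BC (vcross x u) (vcross x v)) (BC (vcross x u) v) in E4.
    move: E1 E2 E3 E4.
    move: (A (vcross v u)) (A (vcross (vcross x v) (vcross x u))) => a1 a2.
    move: (vcross y (B v u)) (vcross y (B (vcross x v) (vcross x u))) => b1 b2.
    move: (vcross (A v) (A u)) (vcross (vcross y (A v)) (vcross y (A u))).
    move=> c1 c2 E1 E2 E3 E4; apply/rowP => i.
    move/rowP/(_ i): E1; move/rowP/(_ i): E2.
    move/rowP/(_ i): E3; move/rowP/(_ i): E4; rewrite !mxE.
    lra.
  move: key; rewrite linearZ scalerA mulrC -scalerA.
  by apply: scalerI; rewrite pnatr_eq0.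
have iso z w : vdot x z = 0 -> vdot x w = 0 ->
    vdot z w = s * vdot (A z) (A w).
  move=> xz xw; have [v [u [xv xu <-]]] := tcross_surj xz.
  rewrite half // dotZl mulrA -expr2 s2 mul1r !tcross_omega ?oA //.
  exact: tA.
have s1 : s = 1.
  have [w w1 /(_ x)] := @exists_perp _ [:: x] isT; rewrite inE => /(_ (eqxx _)) xw.
  have := iso w w xw xw; rewrite w1 => h.
  have /eqP := s2; rewrite sqrf_eq1 => /orP[/eqP//|/eqP sN].
  by have := dot_ge0 (A w); move: h; rewrite sN; lra.
split=> // u v.
have [u' xu ->] := tangent_split x1 u; have [v' xv ->] := tangent_split x1 v.
have eA c w : A (c *: x + w) = c *: y + A w by rewrite linearD linearZ /= Ax.
move: (vdot x u) (vdot x v) => a b.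
rewrite !eA !(dotDl, dotDr, dotZl, dotZr) x1 y1.
rewrite !(vdotC _ x) !(vdotC _ y) !tA // xu xv (iso u' v') // s1.
ring.
Qed.

(** <B v u, A w> is symmetric in v, u and antisymmetric in u, w; such a trilinear
    form vanishes. *)
Lemma isometry_second_derivative0 (A : V -> V) (B : V -> V -> V) :
  (forall w, exists u, A u = w) -> (forall u v, B u v = B v u) ->
  (forall v u w, vdot (B v u) (A w) + vdot (A u) (B v w) = 0) ->
  forall u v, B u v = 0.
Proof.
move=> surjA BC h.
have anti v u w : vdot (B v u) (A w) = - vdot (B v w) (A u).
  by apply/eqP; rewrite -addr_eq0 (vdotC (B v w)) h.
have zero v u w : vdot (B v u) (A w) = 0.
  have : vdot (B v u) (A w) = - vdot (B v u) (A w).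
    rewrite {1}anti (BC v w) (anti w v u) opprK (BC w u) (anti u w v) (BC u v).
    by [].
  lra.
move=> u v; have [w Aw] := surjA (B u v).
by apply/eqP; rewrite -dot_eq0 -{2}Aw zero.
Qed.

End AlmostComplex.

(** * Automorphisms of the octonions *)

Section G2Automorphisms.
Variable R : realType.
Local Notation V := 'rV[R]_7.
Local Notation octonion := 'rV[R]_8.
Implicit Types (u v w : V) (a b : R) (x y z : octonion).

Definition octon a u : octonion := row_mx (a%:M : 'M[R]_1) u.

Lemma octonP x : exists a u, x = octon a u.
Proof.
exists ((lsubmx (x : 'rV[R]_(1 + 7))) 0 0), (rsubmx (x : 'rV[R]_(1 + 7))).
by rewrite /octon -mx11_scalar hsubmxK.
Qed.

Lemma octonD a b u v : octon a u + octon b v = octon (a + b) (u + v).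
Proof. by rewrite /octon (@add_row_mx _ _ 1 7) -raddfD. Qed.

Lemma octonZ a b u : a *: octon b u = octon (a * b) (a *: u).
Proof. by rewrite /octon (@scale_row_mx _ _ 1 7) scale_scalar_mx. Qed.

Lemma octon_inj a b u v : octon a u = octon b v -> a = b /\ u = v.
Proof.
move=> /(@eq_row_mx _ _ 1 7)[/matrixP/(_ 0 0)]; rewrite !mxE !mulr1n.
by [].
Qed.

Lemma octon_imag u : oct_of_imag u = octon 0 u.
Proof. by rewrite /oct_of_imag /octon raddf0. Qed.

Lemma octon1 : oct_e R 0 = octon 1 0.
Proof.
apply/rowP => k; rewrite !mxE; case: splitP => l kl; rewrite !mxE.
  by rewrite !ord1 eqxx (_ : k = 0) ?eqxx //; apply: val_inj; rewrite /= kl ord1.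
have -> : (k == 0) = false by apply/eqP => /(congr1 val)/=; rewrite kl.
by rewrite andbF.
Qed.

Lemma oct_mulDl x y z : oct_mul (x + y) z = oct_mul x z + oct_mul y z.
Proof.
rewrite /oct_mul -big_split; apply: eq_bigr => i _; rewrite -big_split /=.
by apply: eq_bigr => j _; rewrite mxE mulrDl scalerDl.
Qed.
Lemma oct_mulDr x y z : oct_mul z (x + y) = oct_mul z x + oct_mul z y.
Proof.
rewrite /oct_mul -big_split; apply: eq_bigr => i _; rewrite -big_split /=.
by apply: eq_bigr => j _; rewrite mxE mulrDr scalerDl.
Qed.
Lemma oct_mulZl a x z : oct_mul (a *: x) z = a *: oct_mul x z.
Proof.
rewrite /oct_mul scaler_sumr; apply: eq_bigr => i _; rewrite scaler_sumr.
by apply: eq_bigr => j _; rewrite mxE scalerA mulrA.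
Qed.
Lemma oct_mulZr a x z : oct_mul z (a *: x) = a *: oct_mul z x.
Proof.
rewrite /oct_mul scaler_sumr; apply: eq_bigr => i _; rewrite scaler_sumr.
by apply: eq_bigr => j _; rewrite mxE scalerA mulrCA.
Qed.

Lemma oct_mul1l x : oct_mul (oct_e R 0) x = x.
Proof.
rewrite /oct_mul (bigD1 0) //= [X in _ + X]big1 => [|i i0]; last first.
  by rewrite big1 // => j _; rewrite !mxE (negbTE i0) andbF mul0r scale0r.
rewrite addr0 [RHS]row_sum_delta; apply: eq_bigr => j _.
by rewrite /oct_emul eqxx /oct_e mxE !eqxx mul1r.
Qed.

Lemma oct_mul1r x : oct_mul x (oct_e R 0) = x.
Proof.
rewrite /oct_mul exchange_big (bigD1 0) //= [X in _ + X]big1 => [|i i0]; last first.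
  by rewrite big1 // => j _; rewrite !mxE (negbTE i0) andbF mulr0 scale0r.
rewrite addr0 [RHS]row_sum_delta; apply: eq_bigr => j _.
rewrite /oct_emul /oct_e mxE !eqxx mulr1 ?eqxx.
by case: eqP => [->|].
Qed.

Lemma octon_mul a b u v : oct_mul (octon a u) (octon b v) =
  octon (a * b - vdot u v) (a *: v + b *: u + vcross u v).
Proof.
have dec c w : octon c w = c *: oct_e R 0 + oct_of_imag w.
  by rewrite octon1 octonZ octon_imag octonD scaler0 add0r addr0 mulr1.
rewrite {1}(dec a u) oct_mulDl oct_mulZl oct_mul1l (dec b v) oct_mulDr.
rewrite oct_mulZr oct_mul1r oct_mul_imagE -(dec b v) -/(octon _ _).
rewrite octon_imag !octonZ !octonD vdot.unlock vcross.unlock.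
by congr octon; [rewrite mulr0 add0r | rewrite addrA].
Qed.

(** The real and imaginary parts of u v are - <u, v> and u × v, so restriction
    to imaginary octonions identifies automorphisms with linear maps preserving
    both. *)
Lemma G2P (g : {linear V -> V}) : G2 g <->
  (forall u v, g (vcross u v) = vcross (g u) (g v)) /\
  (forall u v, vdot (g u) (g v) = vdot u v).
Proof.
split=> [[phi [_ phi1 phiM] phig]|[gX gD]].
  have key u v : - vdot u v = - vdot (g u) (g v) /\
      g (vcross u v) = vcross (g u) (g v).
    have := phiM (oct_of_imag u) (oct_of_imag v); rewrite !phig !octon_imag.
    rewrite !octon_mul !mulr0 !scale0r !add0r.
    have -> : octon (- vdot u v) (vcross u v) =
        (- vdot u v) *: oct_e R 0 + oct_of_imag (vcross u v).
      by rewrite octon1 octonZ octon_imag octonD scaler0 add0r addr0 mulr1.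
    rewrite linearD linearZ /= phi1 phig octon1 octonZ octon_imag octonD.
    by rewrite scaler0 add0r addr0 mulr1 => /octon_inj.
  by split=> u v; have [/oppr_inj] := key u v.
pose M := lin1_mx g.
pose phi : {linear octonion -> octonion} :=
  mulmxr (block_mx 1%:M 0 0 M : 'M[R]_(1 + 7)).
have phiE a u : phi (octon a u) = octon a (g u).
  rewrite /phi /= /octon (@mul_row_block _ 1 1 7 1 7) !mulmx0 addr0 add0r.
  by rewrite mulmx1 mul_rV_lin1.
have ginj u : g u = 0 -> u = 0.
  by move=> gu; apply/eqP; rewrite -dot_eq0 -gD gu dot0l.
exists phi; last by move=> u; rewrite !octon_imag phiE.
split; last first.
- move=> x y; have [a [u ->]] := octonP x; have [b [v ->]] := octonP y.
  by rewrite octon_mul !phiE octon_mul gD !linearD !linearZ /= gX.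
- by rewrite octon1 phiE linear0.
have Minj : injective phi.
  move=> x y /eqP; rewrite -subr_eq0 -linearB; have [a [u e]] := octonP (x - y).
  rewrite e phiE => /eqP h; apply/eqP; rewrite -subr_eq0 e.
  have h0 : octon a (g u) = octon 0 0 by rewrite h /octon raddf0 (@row_mx0 _ 1 1 7).
  have [-> /ginj ->] := octon_inj h0.
  by rewrite /octon raddf0 (@row_mx0 _ 1 1 7).
have Msurj y : exists x, phi x = y.
  have [b [v ->]] := octonP y; have [u <-] := lin_inj_surj ginj v.
  by exists (octon b u); rewrite phiE.
exists (fun y => projT1 (cid (Msurj y))) => x.
  by apply: Minj; case: cid.
by case: cid.
Qed.

End G2Automorphisms.

(** * Basic triples and connectedness *)

Section Frames.
Variable R : realType.
Local Notation V := 'rV[R]_7.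
Implicit Types (u v w p q a b c : V).

(** Two orthonormal vectors generate a quaternion subalgebra: the table of an
    oriented line of the Fano plane follows from any one of its products. *)
Lemma quaternion_triple p q : vdot p p = 1 -> vdot q q = 1 -> vdot p q = 0 ->
  [/\ vdot (vcross p q) (vcross p q) = 1, vcross q (vcross p q) = p,
      vcross (vcross p q) p = q,
      vdot p (vcross p q) = 0 & vdot q (vcross p q) = 0].
Proof.
move=> p1 q1 pq; split.
- by rewrite dot_cross_cross p1 q1 pq mulr1 mulr0 subr0.
- rewrite (crossC q p) crossNr cross_cross (vdotC q p) pq q1.
  by rewrite scale0r sub0r scale1r opprK.
- by rewrite crossC cross_cross p1 pq scale0r sub0r scale1r opprK.
- by rewrite vdotC triple0'.
- by rewrite vdotC triple0.
Qed.

Lemma cross_anti p q w : vdot p q = 0 -> vdot p w = 0 -> vdot q w = 0 ->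
  vcross p (vcross q w) = - vcross q (vcross p w).
Proof.
move=> pq pw qw; apply/eqP; rewrite -addr_eq0 cross_polar pq pw qw.
by rewrite mulr0 !scale0r subr0 addr0.
Qed.

(** The possible images of (e_1, e_2, e_4) under an automorphism. *)
Definition basic_triple a b c : Prop :=
  [/\ vdot a a = 1, vdot b b = 1 & vdot c c = 1] /\
  [/\ vdot a b = 0, vdot a c = 0, vdot b c = 0 & vdot (vcross a b) c = 0].

(** The images of e_1, ..., e_7: in the given multiplication table
    e_3 = e_1 e_2, e_5 = e_1 e_4, e_6 = e_2 e_4 and e_7 = e_4 e_3. *)
Definition frame a b c : seq V :=
  [:: a; b; vcross a b; c; vcross a c; vcross b c; vcross c (vcross a b)].

Definition frame_mx a b c : 'M[R]_7 := \matrix_(i < 7) (frame a b c)`_i.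

Lemma mul_frame a b c u : u *m frame_mx a b c =
  crd u 0 *: a + crd u 1 *: b + crd u 2 *: vcross a b + crd u 3 *: c
  + crd u 4 *: vcross a c + crd u 5 *: vcross b c
  + crd u 6 *: vcross c (vcross a b).
Proof.
rewrite mulmx_sum_row; under eq_bigr do rewrite crdE rowK.
by rewrite !big_ord_recr /= big_ord0 add0r.
Qed.

(** Seven vectors with the multiplication table of e_1, ..., e_7 multiply by the
    formula crd_cross, the twenty-one equations being three for each line. *)
Lemma cross_table (f0 f1 f2 f3 f4 f5 f6 : V) (x0 x1 x2 x3 x4 x5 x6 : R)
  (y0 y1 y2 y3 y4 y5 y6 : R) :
  vcross f0 f1 = f2 -> vcross f1 f2 = f0 -> vcross f2 f0 = f1 ->
  vcross f0 f3 = f4 -> vcross f3 f4 = f0 -> vcross f4 f0 = f3 ->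
  vcross f0 f5 = f6 -> vcross f5 f6 = f0 -> vcross f6 f0 = f5 ->
  vcross f1 f3 = f5 -> vcross f3 f5 = f1 -> vcross f5 f1 = f3 ->
  vcross f1 f6 = f4 -> vcross f6 f4 = f1 -> vcross f4 f1 = f6 ->
  vcross f2 f6 = f3 -> vcross f6 f3 = f2 -> vcross f3 f2 = f6 ->
  vcross f2 f5 = f4 -> vcross f5 f4 = f2 -> vcross f4 f2 = f5 ->
  vcross (x0 *: f0 + x1 *: f1 + x2 *: f2 + x3 *: f3 + x4 *: f4 + x5 *: f5
          + x6 *: f6)
         (y0 *: f0 + y1 *: f1 + y2 *: f2 + y3 *: f3 + y4 *: f4 + y5 *: f5
          + y6 *: f6) =
  (x1 * y2 - x2 * y1 + x3 * y4 - x4 * y3 + x5 * y6 - x6 * y5) *: f0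
  + (x2 * y0 - x0 * y2 + x3 * y5 - x5 * y3 + x6 * y4 - x4 * y6) *: f1
  + (x0 * y1 - x1 * y0 + x6 * y3 - x3 * y6 + x5 * y4 - x4 * y5) *: f2
  + (x4 * y0 - x0 * y4 + x5 * y1 - x1 * y5 + x2 * y6 - x6 * y2) *: f3
  + (x0 * y3 - x3 * y0 + x1 * y6 - x6 * y1 + x2 * y5 - x5 * y2) *: f4
  + (x6 * y0 - x0 * y6 + x1 * y3 - x3 * y1 + x4 * y2 - x2 * y4) *: f5
  + (x0 * y5 - x5 * y0 + x4 * y1 - x1 * y4 + x3 * y2 - x2 * y3) *: f6.
Proof.
move=> e01 e12 e20 e03 e34 e40 e05 e56 e60 e13 e35 e51 e16 e64 e41.
move=> e26 e63 e32 e25 e54 e42.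
rewrite !(crossDl, crossDr) !(crossZl, crossZr) !crossxx.
rewrite (crossC f0 f1) (crossC f1 f2) (crossC f2 f0) e01 e12 e20.
rewrite (crossC f0 f3) (crossC f3 f4) (crossC f4 f0) e03 e34 e40.
rewrite (crossC f0 f5) (crossC f5 f6) (crossC f6 f0) e05 e56 e60.
rewrite (crossC f1 f3) (crossC f3 f5) (crossC f5 f1) e13 e35 e51.
rewrite (crossC f1 f6) (crossC f6 f4) (crossC f4 f1) e16 e64 e41.
rewrite (crossC f2 f6) (crossC f6 f3) (crossC f3 f2) e26 e63 e32.
rewrite (crossC f2 f5) (crossC f5 f4) (crossC f4 f2) e25 e54 e42.
by apply/rowP => i; rewrite !mxE; ring.
Qed.

(** Orthogonal triples anticommute and antiassociate (cross_anti); this gives one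
    product on each of the seven lines, and quaternion_triple gives the others,
    along with the orthogonality of the points of the line. *)
Lemma frame_G2 a b c : basic_triple a b c ->
  (forall u v, vcross u v *m frame_mx a b c =
     vcross (u *m frame_mx a b c) (v *m frame_mx a b c)) /\
  (forall u v, vdot (u *m frame_mx a b c) (v *m frame_mx a b c) = vdot u v).
Proof.
move=> [[a1 b1 c1] [ab ac bc abc]].
have [s1 bs sa as_ bs0] := quaternion_triple a1 b1 ab.
have [t1 ct ta at_ ct0] := quaternion_triple a1 c1 ac.
have [r1 cr rb br_ cr0] := quaternion_triple b1 c1 bc.
move: (abc); rewrite vdotC => cs.
have [q1 sq qc cq_ sq0] := quaternion_triple c1 s1 cs.
have ar0 : vdot a (vcross b c) = 0 by rewrite dot_crossr.
have ar : vcross a (vcross b c) = vcross c (vcross a b).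
  by rewrite (crossC c b) crossNr cross_anti ?opprK // vdotC.
have [_ rq qa aq0 rq0] := quaternion_triple a1 r1 ar0; rewrite ar in rq qa aq0 rq0.
have bq0 : vdot b (vcross c (vcross a b)) = 0.
  by rewrite (crossC (vcross a b)) dotNr dot_crossr bs ac oppr0.
have bq : vcross b (vcross c (vcross a b)) = vcross a c.
  by rewrite cross_anti // bs -crossC.
have [_ qt tb bt0 qt0] := quaternion_triple b1 q1 bq0; rewrite bq in qt tb bt0 qt0.
have sr0 : vdot (vcross a b) (vcross b c) = 0.
  by rewrite dot_crossr (crossC b) bs dotNl ac oppr0.
have sr : vcross (vcross a b) (vcross b c) = vcross a c.
  by rewrite cross_anti ?(vdotC _ b) // (crossC c) crossNr opprK bq.
have [_ rt ts st0 rt0] := quaternion_triple s1 r1 sr0; rewrite sr in rt ts st0 rt0.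
split=> u v; rewrite !mul_frame.
  rewrite (@cross_table a b (vcross a b) c (vcross a c) (vcross b c)
    (vcross c (vcross a b))) //.
  by rewrite vcross.unlock !crd_cross.
rewrite !(dotDl, dotDr, dotZl, dotZr) (vdotE u v).
rewrite (vdotC b a) ab (vdotC (vcross a b) a) as_.
rewrite (vdotC (vcross a b) b) bs0 (vdotC c a) ac.
rewrite (vdotC (vcross a c) a) at_ (vdotC (vcross a c) c) ct0.
rewrite (vdotC c b) bc (vdotC (vcross b c) b) br_.
rewrite (vdotC (vcross b c) c) cr0 (vdotC (vcross a b) c) cs.
rewrite (vdotC (vcross c (vcross a b)) c) cq_ (vdotC (vcross c (vcross a b)) (vcross a b)) sq0.
rewrite (vdotC (vcross b c) a) ar0 (vdotC (vcross c (vcross a b)) a) aq0.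
rewrite (vdotC (vcross c (vcross a b)) (vcross b c)) rq0 (vdotC (vcross c (vcross a b)) b) bq0.
rewrite (vdotC (vcross a c) b) bt0 (vdotC (vcross a c) (vcross c (vcross a b))) qt0.
rewrite (vdotC (vcross b c) (vcross a b)) sr0 (vdotC (vcross a c) (vcross a b)) st0.
rewrite (vdotC (vcross a c) (vcross b c)) rt0.
by rewrite a1 b1 c1 s1 t1 r1 q1; ring.
Qed.

(** Coordinates start at 0, so ev 0, ev 1, ev 3 are e_1, e_2, e_4. *)
Definition ev (n : nat) : V := delta_mx 0 (inord n).

Lemma crd_ev n m : (n < 7)%N -> (m < 7)%N -> crd (ev n) m = (n == m)%:R.
Proof.
move=> n7 m7; rewrite /crd /ev mxE eqxx /= eq_sym; congr (_%:R).
by rewrite -(inj_eq val_inj) /= !inordK.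
Qed.

Lemma basic_triple_ev : basic_triple (ev 0) (ev 1) (ev 3).
Proof.
by split; split; rewrite vdotE ?vcross.unlock ?crd_cross !crd_ev //=; ring.
Qed.

Lemma cross_ev : ((vcross (ev 0) (ev 1) = ev 2) * (vcross (ev 0) (ev 3) = ev 4)) *
  ((vcross (ev 1) (ev 3) = ev 5) * (vcross (ev 3) (ev 2) = ev 6)).
Proof.
split; split; apply: crd_inj; case=> [|[|[|[|[|[|[|//]]]]]]] _;
  by rewrite vcross.unlock crd_cross !crd_ev //=; ring.
Qed.

Lemma frame_mx_ev u : u *m frame_mx (ev 0) (ev 1) (ev 3) = u.
Proof.
rewrite mul_frame !cross_ev; apply: crd_inj => n n7.
rewrite !(crdD, crdZ) !crd_ev //; move: n n7.
by case=> [|[|[|[|[|[|[|//]]]]]]] _ /=; ring.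
Qed.

Lemma G2_frame (g : {linear V -> V}) :
  (forall u v, g (vcross u v) = vcross (g u) (g v)) ->
  (forall u v, vdot (g u) (g v) = vdot u v) ->
  basic_triple (g (ev 0)) (g (ev 1)) (g (ev 3)) /\
  forall u, g u = u *m frame_mx (g (ev 0)) (g (ev 1)) (g (ev 3)).
Proof.
move=> gX gD; split.
  have [[h1 h2 h3] [h4 h5 h6 h7]] := basic_triple_ev.
  by split; split; rewrite -?gX gD.
move=> u; rewrite -{1}[u]frame_mx_ev !mul_frame !linearD !linearZ /=.
by rewrite !gX.
Qed.

(** Two points of the unit sphere of the complement of L lie on a great circle of
    that sphere.  The bound on the size of L leaves room for a direction d even
    when q = p or q = - p. *)
Lemma exists_arc (L : seq V) p q : (size L <= 5)%N ->
  vdot p p = 1 -> vdot q q = 1 -> (forall x, x \in L -> vdot x p = 0) ->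
  (forall x, x \in L -> vdot x q = 0) ->
  exists d (theta : R), [/\ vdot d d = 1, vdot p d = 0,
    forall x, x \in L -> vdot x d = 0 &
    q = cos theta *: p + sin theta *: d].
Proof.
move=> sL p1 q1 pL qL; pose al := vdot p q; pose w := q - al *: p.
have ww : vdot w w = 1 - al ^+ 2.
  rewrite /w !(dotBl, dotBr) !(dotZl, dotZr) p1 q1 (vdotC q p) -/al; ring.
have pw : vdot p w = 0 by rewrite dotBr dotZr p1 mulr1 subrr.
have al1 : -1 <= al <= 1.
  by have := dot_ge0 w; rewrite ww => h; apply/andP; split; nra.
have [w0|w0] := eqVneq w 0.
  have [d d1 dL] := @exists_perp _ (p :: L) sL.
  exists d, (acos al); split=> //.
  - by rewrite dL // inE eqxx.
  - by move=> x xL; rewrite dL // inE xL orbT.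
  rewrite acosK ?in_itv //= sin_acos // -ww w0 dot0l sqrtr0 scale0r addr0.
  by apply/eqP; rewrite -subr_eq0 -/w w0.
have ww0 : vdot w w != 0 by rewrite dot_eq0.
have sw : Num.sqrt (vdot w w) != 0.
  by rewrite gt_eqF // sqrtr_gt0 lt_neqAle eq_sym ww0 dot_ge0.
exists ((Num.sqrt (vdot w w))^-1 *: w), (acos al); split.
- rewrite dotZl dotZr mulrA -invfM -expr2 sqr_sqrtr ?dot_ge0 //.
  by rewrite mulVf.
- by rewrite dotZr pw mulr0.
- move=> x xL; rewrite dotZr [vdot x w]dotBr (dotZr al) pL // qL //.
  by rewrite mulr0 subrr mulr0.
rewrite acosK ?in_itv //= sin_acos // -ww scalerA mulfV // scale1r.
by rewrite /w addrC subrK.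
Qed.

Definition arc p d (t : R) : V := cos t *: p + sin t *: d.

Lemma arc_unit p d t : vdot p p = 1 -> vdot d d = 1 -> vdot p d = 0 ->
  vdot (arc p d t) (arc p d t) = 1.
Proof.
move=> p1 d1 pd; rewrite !(dotDl, dotDr, dotZl, dotZr) p1 d1 (vdotC d p) pd.
by rewrite -[RHS](cos2Dsin2 t); ring.
Qed.

Lemma arc_perp p d t x : vdot x p = 0 -> vdot x d = 0 -> vdot x (arc p d t) = 0.
Proof. by move=> xp xd; rewrite dotDr !dotZr xp xd !mulr0 addr0. Qed.

Lemma arc0 p d : arc p d 0 = p.
Proof. by rewrite /arc cos0 sin0 scale1r scale0r addr0. Qed.

Definition continuous_curve (k : R -> V) : Prop :=
  forall n, continuous (fun t => crd (k t) n).

Lemma arc_continuous p d : continuous_curve (arc p d).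
Proof.
move=> n t; rewrite /arc; under eq_fun do rewrite crdD !crdZ.
apply: cvgD; apply: cvgM; try exact: cvg_cst.
  exact: continuous_cos.
exact: continuous_sin.
Qed.

Lemma cst_curve p : continuous_curve (fun=> p).
Proof. by move=> n t; exact: cvg_cst. Qed.

Lemma continuous_sumr (I : Type) (r : seq I) (f : I -> R -> R) :
  (forall i, continuous (f i)) -> continuous (fun t => \sum_(i <- r) f i t).
Proof.
move=> fc; elim: r => [|i r IH] t.
  by under eq_fun do rewrite big_nil; exact: cvg_cst.
under eq_fun do rewrite big_cons.
by apply: cvgD; [exact: fc|exact: IH].
Qed.

Lemma cross_curve (k l : R -> V) : continuous_curve k -> continuous_curve l ->
  continuous_curve (fun t => vcross (k t) (l t)).
Proof.
move=> kc lc n t.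
have E m : (fun t => crd (vcross (k t) (l t)) m) =
    (fun t => \sum_(i < 7) \sum_(j < 7) crd (k t) i * crd (l t) j * ceps R i j (inord m : 'I_7)).
  by apply/funext => t'; rewrite vcross.unlock /crd cross_icross mxE.
rewrite E; apply: continuous_sumr => i; apply: continuous_sumr => j s.
by apply: cvgM; [apply: cvgM; [exact: kc|exact: lc]|exact: cvg_cst].
Qed.

(** For fixed a and b, the vector c ranges over a unit 3-sphere. *)
Lemma basic_tripleC a b c : basic_triple a b c <->
  [/\ vdot a a = 1, vdot b b = 1, vdot c c = 1, vdot a b = 0 &
      forall x, x \in [:: a; b; vcross a b] -> vdot x c = 0].
Proof.
split=> [[[a1 b1 c1] [ab ac bc abc]]|[a1 b1 c1 ab h]]; split=> //.
  by move=> x; rewrite !inE => /or3P[] /eqP ->.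
by split=> //; apply: h; rewrite !inE eqxx ?orbT.
Qed.

Lemma basic_triple_rot a b c : basic_triple a b c -> basic_triple b c a.
Proof.
move=> [[a1 b1 c1] [ab ac bc abc]]; split; split=> //.
- by rewrite vdotC.
- by rewrite vdotC.
- by rewrite -triple_cyc.
Qed.

(** Quantifying over properties transported along curves avoids committing to a
    topology on the set of triples; it will be applied to the property that the
    corresponding element of G_2 lies in the identity component. *)
Definition curve_closed (Q : V -> V -> V -> Prop) : Prop :=
  forall k l m : R -> V,
    [/\ continuous_curve k, continuous_curve l & continuous_curve m] ->
    (forall t, basic_triple (k t) (l t) (m t)) ->
    forall t, Q (k 0) (l 0) (m 0) -> Q (k t) (l t) (m t).

Lemma curve_closed_rot Q : curve_closed Q -> curve_closed (fun a b c => Q b c a).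
Proof.
move=> cQ k l m [kc lc mc] h t; apply: (cQ l m k) => // t'.
exact: basic_triple_rot.
Qed.

Lemma curve_closed_move Q a b p q : curve_closed Q ->
  basic_triple a b p -> basic_triple a b q -> Q a b p -> Q a b q.
Proof.
move=> cQ /basic_tripleC[a1 b1 p1 ab pL] /basic_tripleC[_ _ q1 _ qL].
have [d [t [d1 pd dL ->]]] := @exists_arc [:: a; b; vcross a b] p q isT p1 q1 pL qL.
rewrite -{1}(arc0 p d).
apply: (cQ (fun=> a) (fun=> b) (arc p d)).
  split; [exact: cst_curve|exact: cst_curve|exact: arc_continuous].
move=> s; apply/basic_tripleC; split=> //; first exact: arc_unit.
by move=> x xL; apply: arc_perp; [exact: pL|exact: dL].
Qed.

(** The path from (e_1, e_2, e_4) to (a, b, c) passes through (e_1, e_2, d),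
    (e_1, b', d), (e_1, b', c'), (a, b', c') and (a, b', c).  The vectors b', c', d
    exist because each is subject to at most five linear conditions. *)
Lemma basic_triples_connected Q : curve_closed Q -> Q (ev 0) (ev 1) (ev 3) ->
  forall a b c, basic_triple a b c -> Q a b c.
Proof.
move=> cQ Q0 a b c babc; have e := basic_triple_ev.
have cQ1 := curve_closed_rot cQ; have cQ2 := curve_closed_rot cQ1.
have [[a1 b1 c1] [ab ac bc abc]] := babc.
have [[e1 f1 _] [ef _ _ _]] := e.
have [b' b'1 Lb'] := @exists_perp _ [:: a; c; vcross c a; ev 0] isT.
have [ab' cb' acb' eb'] : [/\ vdot a b' = 0, vdot c b' = 0,
    vdot (vcross c a) b' = 0 & vdot (ev 0) b' = 0].
  by split; apply: Lb'; rewrite !inE eqxx ?orbT.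
have [c' c'1 Lc'] :=
  @exists_perp _ [:: a; b'; vcross a b'; ev 0; vcross (ev 0) b'] isT.
have [ac' bc' abc' ec' ebc'] : [/\ vdot a c' = 0, vdot b' c' = 0,
    vdot (vcross a b') c' = 0, vdot (ev 0) c' = 0 & vdot (vcross (ev 0) b') c' = 0].
  by split; apply: Lc'; rewrite !inE eqxx ?orbT.
have [d d1 Ld] :=
  @exists_perp _ [:: ev 0; ev 1; vcross (ev 0) (ev 1); b'; vcross (ev 0) b'] isT.
have [e0d e1d e01d bd ebd] : [/\ vdot (ev 0) d = 0, vdot (ev 1) d = 0,
    vdot (vcross (ev 0) (ev 1)) d = 0, vdot b' d = 0 & vdot (vcross (ev 0) b') d = 0].
  by split; apply: Ld; rewrite !inE eqxx ?orbT.
have t1 : basic_triple (ev 0) (ev 1) d by split; split.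
have t2 : basic_triple (ev 0) b' d by split; split.
have t3 : basic_triple (ev 0) b' c' by split; split.
have t4 : basic_triple a b' c' by split; split.
have t5 : basic_triple a b' c.
  by split; split=> //; [rewrite vdotC|rewrite -triple_cyc].
have Q1 := curve_closed_move cQ e t1 Q0.
have r := basic_triple_rot.
have Q2 : Q (ev 0) b' d.
  exact: (curve_closed_move cQ1 (r _ _ _ (r _ _ _ t1)) (r _ _ _ (r _ _ _ t2)) Q1).
have Q3 := curve_closed_move cQ t2 t3 Q2.
have Q4 : Q a b' c'.
  exact: (curve_closed_move cQ2 (r _ _ _ t3) (r _ _ _ t4) Q3).
have Q5 := curve_closed_move cQ t4 t5 Q4.
exact: (curve_closed_move cQ1 (r _ _ _ (r _ _ _ t5)) (r _ _ _ (r _ _ _ babc)) Q5).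
Qed.

End Frames.

(** * Differentiation in R^7 *)

Section DifferentiationTools.
Variable R : realType.
Local Notation V := 'rV[R]_7.
Implicit Types (u v w x y : V).

Lemma near_eq_differentiable (U W : normedModType R) (f g : U -> W) (x : U) :
  (\near x, f x = g x) -> differentiable f x -> differentiable g x.
Proof.
move=> fg df; have [dfc dfE] := (diff_locallyP _ _).1 df.
have fgx : f x = g x by exact: nbhs_singleton fg.
have H : g \o shift x = cst (g x) + 'd f x +o_ 0 id.
  apply/eqaddoP => e e0; have /eqaddoP/(_ e e0) := dfE.
  have fg0 : \forall h \near 0, f (h + x) = g (h + x).
    by move: fg; rewrite (near_shift 0) subr0; apply.
  apply: filterS2 fg0 => h fgh; rewrite /= !fctE /=.
  by rewrite fgh fgx.
have dE := diff_unique dfc H.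
by apply/diff_locallyP; rewrite dE; split.
Qed.

Lemma near_neq0 x : x != 0 -> \forall y \near x, y != 0.
Proof.
move=> x0; have e0 : 0 < `|x| by rewrite normr_gt0.
near=> y; apply: contraTneq isT => y0.
have : `|x - y| < `|x| by near: y; apply/nbhs_ballP; exists `|x| => //= z; rewrite -ball_normE.
by rewrite y0 subr0 ltxx.
Unshelve. all: by end_near. Qed.

Lemma differentiable_crd n x : differentiable (fun y => crd y n : R) x.
Proof. exact: differentiable_coord. Qed.

Lemma rV_sum_crd x : x = \sum_(i < 7) crd x i *: ev R i.
Proof.
rewrite {1}[x]row_sum_delta; apply: eq_bigr => i _.
by rewrite /crd /ev inord_val.
Qed.

Lemma differentiable_row (U : normedModType R) (F : U -> V) (x : U) :
  (forall n, differentiable (fun y : U => crd (F y) n : R) x) -> differentiable F x.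
Proof.
move=> h; have -> : F = \sum_(i < 7) (fun y : U => crd (F y) i *: ev R i).
  apply/funext => y; rewrite {1}(rV_sum_crd (F y)).
  by elim/big_ind2 : _ => // f g h1 h2 -> ->.
apply: differentiable_sum => i; exact: differentiableZl.
Qed.

Lemma derive_crd (U : normedModType R) (F : U -> V) (x v : U) n :
  derivable F x v -> crd ('D_v F x) n = 'D_v (fun y : U => crd (F y) n : R) x.
Proof. by move=> dF; rewrite derive_mx // /crd mxE. Qed.

Lemma differentiable_vdot (U : normedModType R) (F G : U -> V) (x : U) :
  differentiable F x -> differentiable G x ->
  differentiable (fun y : U => vdot (F y) (G y)) x.
Proof.
move=> dF dG; have dc (H : U -> V) n : differentiable H x ->
    differentiable (fun y : U => crd (H y) n : R) x.
  move=> dH; exact: (differentiable_comp dH (differentiable_crd n (H x))).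
under eq_fun do rewrite vdotE.
do !apply: differentiableD; apply: differentiableM; exact: dc.
Qed.

Definition nu x : R := (Num.sqrt (vdot x x))^-1.

Lemma nu_gt0 x : x != 0 -> 0 < nu x.
Proof. by move=> x0; rewrite invr_gt0 sqrtr_gt0 dot_gt0. Qed.

Lemma nu2 x : x != 0 -> nu x * nu x * vdot x x = 1.
Proof.
move=> x0; rewrite -invfM -expr2 sqr_sqrtr ?dot_ge0 // mulVf //.
by rewrite gt_eqF // dot_gt0.
Qed.

Lemma differentiable_nu x : x != 0 -> differentiable nu x.
Proof.
move=> x0; apply: differentiableV.
  apply: (@differentiable_comp _ _ _ _ (fun y => vdot y y) Num.sqrt).
    by apply: differentiable_vdot.
  apply/derivable1_diffP.
  by have [] := @is_derive1_sqrt _ (vdot x x); rewrite ?dot_gt0.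
by rewrite gt_eqF // sqrtr_gt0 dot_gt0.
Qed.

Lemma derive_vdot (U : normedModType R) (F G : U -> V) (x v : U) :
  derivable F x v -> derivable G x v ->
  'D_v (fun y : U => vdot (F y) (G y)) x = vdot ('D_v F x) (G x) + vdot (F x) ('D_v G x).
Proof.
move=> dF dG; have dc (H : U -> V) n : derivable H x v ->
    derivable (fun y : U => crd (H y) n : R) x v.
  by move=> dH; exact: (derivable_mxP _ _ _).1.
have E : (fun y : U => vdot (F y) (G y)) =
   \sum_(i < 7) ((fun y : U => crd (F y) i) * (fun y : U => crd (G y) i)).
  apply/funext => y; rewrite vdotE !big_ord_recr /= big_ord0.
  by rewrite !fctE add0r.
rewrite E derive_sum; last by move=> i; apply: derivableM; exact: dc.
have dM (i : 'I_7) := deriveM (dc F i dF) (dc G i dG).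
under eq_bigr => i _ do rewrite dM -(derive_crd _ dF) -(derive_crd _ dG).
rewrite !vdotE !big_ord_recr /= big_ord0 /GRing.scale /=.
move: (crd (F x)) (crd (G x)) (crd ('D_v F x)) (crd ('D_v G x)) => a b c d.
ring.
Qed.

(** Obtained by differentiating the identity nu^2 <x, x> = 1, given that nu is
    differentiable. *)
Lemma derive_nu v x : x != 0 ->
  'D_v nu x = - (nu x * nu x * nu x * vdot x v).
Proof.
move=> x0; have dn : derivable nu x v by exact/diff_derivable/differentiable_nu.
have did : derivable (id : V -> V) x v by exact: derivable_id.
have dq : derivable (fun y => vdot y y) x v.
  by apply/diff_derivable/differentiable_vdot.
have : 'D_v (nu * nu * (fun y => vdot y y)) x = 0.
  rewrite -(derive_cst (1 : R) x v); apply: near_eq_derive.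
  by near do apply: nu2; exact: near_neq0.
rewrite (deriveM (derivableM dn dn) dq) (derive_vdot did did) (deriveM dn dn).
rewrite !derive_id /GRing.scale /= !fctE (vdotC v x).
have n0 := nu_gt0 x0; have q0 : 0 < vdot x x by rewrite dot_gt0.
have := nu2 x0; move: n0 q0; move: (nu x) (vdot x x) (vdot x v) ('D_v nu x).
move=> n q p D n0 q0 h2 h; have {}h : n * q * D = - (n * n * p) by lra.
apply: (@mulfI _ (n * q)); first by rewrite gt_eqF // mulr_gt0.
by rewrite h -[LHS]mulr1 -h2; ring.
Unshelve. all: by end_near. Qed.

End DifferentiationTools.

(** * Derivatives of the radial projection *)

Section RadialFunctions.
Variable R : realType.
Local Notation V := 'rV[R]_7.
Implicit Types (u v w x y : V).

(** The algebra generated by the coordinates and 1 / |x|.  It is stable under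
    directional derivatives, and boundedness of its elements on the unit sphere
    is clear by induction. *)
Inductive radial_alg : (V -> R) -> Prop :=
| Ralg_cst (a : R) : radial_alg (fun=> a)
| Ralg_crd n : radial_alg (fun x => crd x n)
| Ralg_nu : radial_alg (@nu R)
| Ralg_add f g : radial_alg f -> radial_alg g -> radial_alg (fun x => f x + g x)
| Ralg_mul f g : radial_alg f -> radial_alg g -> radial_alg (fun x => f x * g x).

Lemma radial_alg_differentiable f x : radial_alg f -> x != 0 -> differentiable f x.
Proof.
move=> af x0; elim: af => [a|n||g h _ dg _ dh|g h _ dg _ dh].
- exact: differentiable_cst.
- exact: differentiable_crd.
- exact: differentiable_nu.
- exact: differentiableD.
- exact: differentiableM.
Qed.

Definition radial_field (F : V -> V) := forall n, radial_alg (fun x => crd (F x) n).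

Lemma radial_alg_vdot F G : radial_field F -> radial_field G ->
  radial_alg (fun x => vdot (F x) (G x)).
Proof.
move=> aF aG; under eq_fun do rewrite vdotE.
have term n : radial_alg (fun x => crd (F x) n * crd (G x) n) by exact: Ralg_mul.
by do 6 (apply: Ralg_add; last exact: term); exact: term.
Qed.

Lemma radial_field_id : radial_field id.
Proof. by move=> n; exact: Ralg_crd. Qed.

Lemma radial_field_cst v : radial_field (fun=> v).
Proof. by move=> n; exact: Ralg_cst. Qed.

Lemma radial_alg_derive f v : radial_alg f ->
  exists2 g, radial_alg g & forall x, x != 0 -> 'D_v f x = g x.
Proof.
elim=> [a|n||g h ag [g' ag' dg] ah [h' ah' dh]|g h ag [g' ag' dg] ah [h' ah' dh]].
- by exists (fun=> 0); [exact: Ralg_cst|move=> x _; exact: derive_cst].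
- exists (fun=> crd v n); first exact: Ralg_cst.
  move=> x _; have did : derivable (id : V -> V) x v by exact: derivable_id.
  by rewrite -(derive_crd n did) derive_id.
- exists (fun x => -1 * (nu x * nu x * nu x * vdot x v)).
    apply: Ralg_mul; first exact: Ralg_cst.
    apply: Ralg_mul; last first.
      exact: radial_alg_vdot radial_field_id (radial_field_cst v).
    by apply: Ralg_mul; [apply: Ralg_mul|]; exact: Ralg_nu.
  by move=> x x0; rewrite derive_nu // mulN1r.
- exists (fun x => g' x + h' x); first exact: Ralg_add.
  move=> x x0; have dgx := @diff_derivable _ _ _ _ _ v (radial_alg_differentiable ag x0).
  have dhx := @diff_derivable _ _ _ _ _ v (radial_alg_differentiable ah x0).
  by rewrite -dg // -dh // -(deriveD dgx dhx).
- exists (fun x => g x * h' x + h x * g' x).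
    by apply: Ralg_add; apply: Ralg_mul.
  move=> x x0; have dgx := @diff_derivable _ _ _ _ _ v (radial_alg_differentiable ag x0).
  have dhx := @diff_derivable _ _ _ _ _ v (radial_alg_differentiable ah x0).
  by rewrite -dg // -dh //; exact: (deriveM dgx dhx).
Qed.

Lemma radial_alg_bounded f : radial_alg f ->
  exists M, forall x, vdot x x = 1 -> `|f x| <= M.
Proof.
elim=> [a|n||g h _ [M HM] _ [N HN]|g h _ [M HM] _ [N HN]].
- by exists `|a|.
- exists 1 => x x1; rewrite ler_norml.
  have : crd x n ^+ 2 <= 1.
    rewrite -x1 vdot.unlock /dot (bigD1 (inord n)) //= -expr2 lerDl.
    by apply: sumr_ge0 => i _; rewrite -expr2 sqr_ge0.
  by move=> h; apply/andP; split; nra.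
- by exists 1 => x x1; rewrite /nu x1 sqrtr1 invr1 normr1.
- exists (M + N) => x x1; apply: (le_trans (ler_normD _ _)).
  by apply: lerD; [exact: HM|exact: HN].
- exists (M * N) => x x1; rewrite normrM; apply: ler_pM => //.
    exact: HM.
  exact: HN.
Qed.

Lemma radial_field_differentiable F x : radial_field F -> x != 0 -> differentiable F x.
Proof.
by move=> aF x0; apply: differentiable_row => n; exact: radial_alg_differentiable.
Qed.

(** A directional derivative at x depends on the function near x only, so it is
    enough to know F away from the origin, where the derivative then belongs to
    the algebra again. *)
Lemma iter_derive_radial (F G : V -> V) vs : radial_field G ->
  (forall x, x != 0 -> F x = G x) ->
  exists2 H, radial_field H & forall x, x != 0 -> iter_derive vs F x = H x.
Proof.
move=> aG FG; elim: vs => [|v vs [H aH HE]] /=; first by exists G.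
have /choice[g gE] n : exists g, radial_alg g /\
    forall x, x != 0 -> 'D_v (fun x => crd (H x) n : R) x = g x.
  by have [g ? ?] := radial_alg_derive v (aH n); exists g.
exists (fun x => \row_(i < 7) g i x).
  move=> n; have -> : (fun x => crd (\row_(i < 7) g i x) n) = g (inord n : 'I_7).
    by apply/funext => x; rewrite /crd mxE.
  exact: (gE _).1.
move=> x x0; have -> : 'D_v (iter_derive vs F) x = 'D_v H x.
  by apply: near_eq_derive; near do apply: HE; exact: near_neq0.
apply: crd_inj => n n7; rewrite derive_crd; last first.
  exact/diff_derivable/radial_field_differentiable.
by rewrite (gE n).2 // /crd mxE inordK.
Unshelve. all: by end_near. Qed.

Definition unitv x : V := sval (sphere6_proj x).

Lemma sphereP (p : sphere6 R) : vdot (sval p) (sval p) = 1.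
Proof. by rewrite vdot.unlock; exact/eqP/(svalP p). Qed.

Lemma sphere_neq0 (p : sphere6 R) : sval p != 0.
Proof. by rewrite -dot_eq0 sphereP oner_eq0. Qed.

Lemma unitvE x : x != 0 -> unitv x = nu x *: x.
Proof.
move=> x0; rewrite /unitv /sphere6_proj dot_vdot -/(nu x).
have h : dot (nu x *: x) (nu x *: x) == 1.
  by rewrite dot_vdot dotZl dotZr mulrA nu2.
by have := insubdK (sphere6_base R) h.
Qed.

Lemma unitv_sphere (p : sphere6 R) : sphere6_proj (sval p) = p.
Proof.
apply: val_inj; rewrite -[LHS]/(unitv (sval p)) unitvE ?sphere_neq0 //.
by rewrite /nu sphereP sqrtr1 invr1 scale1r.
Qed.

Lemma radial_field_nu : radial_field (fun x => nu x *: x).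
Proof.
move=> n; have -> : (fun x => crd (nu x *: x) n) = (fun x => nu x * crd x n).
  by apply/funext => x; rewrite crdZ.
by apply: Ralg_mul; [exact: Ralg_nu|exact: Ralg_crd].
Qed.

Lemma iter_derive_unitv vs :
  exists2 H, radial_field H & forall x, x != 0 -> iter_derive vs unitv x = H x.
Proof. by apply: iter_derive_radial radial_field_nu _ => x; exact: unitvE. Qed.

Lemma iter_derive_unitv_bounded vs : exists M, forall (p : sphere6 R) n,
  `|crd (iter_derive vs unitv (sval p)) n| <= M.
Proof.
have [H aH HE] := iter_derive_unitv vs.
have /choice[M ME] n := radial_alg_bounded (aH n).
exists (\sum_(i < 7) `|M i|) => p n; rewrite HE ?sphere_neq0 //.
have -> : crd (H (sval p)) n = crd (H (sval p)) (inord n : 'I_7).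
  by rewrite /crd inord_val.
apply: (le_trans (ME _ _ (sphereP p))); apply: (le_trans (ler_norm _)).
by rewrite (bigD1 (inord n)) //= lerDl sumr_ge0.
Qed.

Lemma iter_derive_unitv_differentiable vs x : x != 0 ->
  differentiable (iter_derive vs unitv) x.
Proof.
move=> x0; have [H aH HE] := iter_derive_unitv vs.
apply: near_eq_differentiable (radial_field_differentiable aH x0).
by near do rewrite HE //; exact: near_neq0.
Unshelve. all: by end_near. Qed.

End RadialFunctions.

(** * Linear isometries acting on the sphere *)

Section G2Action.
Variable R : realType.
Local Notation V := 'rV[R]_7.
Implicit Types (u v w x y : V) (M N : 'M[R]_7).

Lemma crd_mulmx x M n : crd (x *m M) n = \sum_(i < 7) crd x i * M i (inord n).
Proof. by rewrite /crd mxE; apply: eq_bigr => i _; rewrite inord_val. Qed.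

Lemma mulmxr_continuous M : continuous (fun x => x *m M).
Proof.
move=> x; apply: differentiable_continuous; apply: differentiable_row => n.
have -> : (fun y => crd (y *m M) n) =
    \sum_(i < 7) (fun y => crd y i * M i (inord n)).
  apply/funext => y; rewrite crd_mulmx.
  by elim/big_ind2 : _ => // f g h1 h2 -> ->.
apply: differentiable_sum => i; apply: differentiableM.
  exact: differentiable_crd.
exact: differentiable_cst.
Qed.

Lemma differentiable_mulmxr M x : differentiable (fun x => x *m M) x.
Proof. exact: (@linear_differentiable _ _ _ (mulmxr M) x (@mulmxr_continuous M)). Qed.

Lemma derive_mulmxr (F : V -> V) M x v : differentiable F x ->
  'D_v (fun y => F y *m M) x = 'D_v F x *m M.
Proof.
move=> dF; have dM := differentiable_mulmxr M (F x).
have dc : differentiable (fun y => F y *m M) x := differentiable_comp dF dM.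
rewrite (deriveE _ dc) (deriveE _ dF).
have dE := diff_comp dF dM.
have dl := @diff_lin _ _ _ (mulmxr M) (F x) (@mulmxr_continuous M).
exact: etrans (congr1 (fun h : V -> V => h v) dE)
              (congr1 (fun h : V -> V => h ('d F x v)) dl).
Qed.

Lemma iter_derive_mulmxr vs M x : x != 0 ->
  iter_derive vs (fun y => unitv y *m M) x = iter_derive vs (@unitv R) x *m M.
Proof.
elim: vs x => //= v vs IH x x0.
rewrite -derive_mulmxr; last exact: iter_derive_unitv_differentiable.
by apply: near_eq_derive; near do apply: IH; exact: near_neq0.
Unshelve. all: by end_near. Qed.

Definition isometric M := forall u v, vdot (u *m M) (v *m M) = vdot u v.

(** Projecting back to the sphere makes this total; the projection does nothing
    when M is an isometry. *)
Definition act M : sphere6 R -> sphere6 R := fun p => sphere6_proj (sval p *m M).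

Lemma act_val M p : isometric M -> sval (act M p) = sval p *m M.
Proof.
move=> iM; have pM : vdot (sval p *m M) (sval p *m M) = 1 by rewrite iM sphereP.
rewrite -[LHS]/(unitv _) unitvE; last by rewrite -dot_eq0 pM oner_eq0.
by rewrite /nu pM sqrtr1 invr1 scale1r.
Qed.

Lemma radial_ext_act M : isometric M ->
  radial_ext (act M) = (fun x => unitv x *m M).
Proof. by move=> iM; apply/funext => x; rewrite /radial_ext act_val. Qed.

Lemma norm_rV_lt u (e : R) : 0 < e -> (forall n, `|crd u n| < e) -> `|u| < e.
Proof.
move=> e0 h; rewrite [`|u|]mx_normrE; apply: bigmax_lt => //= -[i j] _ /=.
by rewrite ord1 crdE.
Qed.

(** The derivatives of act (M t) are those of x / |x| multiplied by M t.  As the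
    former are bounded on the sphere, entrywise continuity of M gives uniform
    convergence of each derivative. *)
Lemma act_continuous (M : R -> 'M[R]_7) : (forall t, isometric (M t)) ->
  (forall i j, continuous (fun t => M t i j)) ->
  continuous ((fun t => act (M t)) : R -> Cinfty_selfmap R).
Proof.
move=> iM cM; apply: continuous_comp_initial => t0.
apply/cvg_sup => vs; move: t0; apply: continuous_comp_initial => t0 A.
move=> /uniform_nbhs[E [+ EA]]; rewrite -entourage_ballE => -[e /= e0 eE].
have [B HB] := iter_derive_unitv_bounded vs (R := R).
have B0 : 0 <= B by apply: le_trans (HB (sphere6_base R) 0).
(* A coordinate of the product with a matrix is a sum of seven terms of size at
   most B d; the summand 1 covers the case B = 0. *)
pose d := e / (7 * (B + 1)).
have d0 : 0 < d by rewrite divr_gt0 // mulr_gt0 // ltr_wpDl.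
have near_M : \forall t \near t0, forall ij : 'I_7 * 'I_7,
    `|M t0 ij.1 ij.2 - M t ij.1 ij.2| < d.
  have H (ij : 'I_7 * 'I_7) :
      \forall t \near t0, `|M t0 ij.1 ij.2 - M t ij.1 ij.2| < d.
    by have /cvgrPdist_lt/(_ d d0) := cM ij.1 ij.2 t0.
  exact: (@filter_forall _ _ _ _ _ H).
apply: filterS near_M => t Mt; apply: EA => p _; apply: eE => /=.
rewrite /all_derivatives !radial_ext_act // !iter_derive_mulmxr ?sphere_neq0 //.
rewrite -ball_normE /= -mulmxBr; apply: norm_rV_lt => // n.
rewrite crd_mulmx; apply: (@le_lt_trans _ _ (\sum_(i < 7) B * d)).
  apply: (le_trans (ler_norm_sum _ _ _)); apply: ler_sum => i _.
  rewrite normrM ler_pM // ?HB // !mxE ltW //.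
  exact: (Mt (i, inord n)).
rewrite sumr_const card_ord -mulr_natl /d.
have -> : 7%:R * (B * (e / (7 * (B + 1)))) = e * (B / (B + 1)).
  by field; rewrite gt_eqF // ltr_wpDl.
by rewrite gtr_pMr // ltr_pdivrMr ?mul1r ?ltrDl // ltr_wpDl.
Qed.

End G2Action.

(** * G_2 lies in the identity component *)

Section G2Component.
Variable R : realType.
Local Notation V := 'rV[R]_7.
Implicit Types (a b c u v w x y : V) (M N : 'M[R]_7).

Lemma sphere_inj (p q : sphere6 R) : sval p = sval q -> p = q.
Proof. exact: val_inj. Qed.

Lemma smooth_mulmxr M : smooth_on setT (fun x : V => x *m M).
Proof.
move=> vs x _.
have [N [c ->]] : exists N (c : V), iter_derive vs (fun x => x *m M) = (fun x => x *m N + c).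
  elim: vs => [|v vs [N [c IH]]] /=.
    by exists M, 0; apply/funext => y; rewrite addr0.
  exists 0, (v *m N); apply/funext => y; rewrite IH mulmx0 add0r.
  have dN := @diff_derivable _ _ _ _ _ v (differentiable_mulmxr N y).
  rewrite (deriveD dN (derivable_cst c y v)) derive_cst addr0.
  rewrite -[RHS](congr1 (mulmx^~ N) (derive_id y v)).
  by apply: (@derive_mulmxr _ id).
apply: differentiableD; first exact: differentiable_mulmxr.
exact: differentiable_cst.
Qed.

Lemma act_smooth M : isometric M -> smooth (act M).
Proof.
move=> iM p; exists setT, (fun x => x *m M); split.
- by split; [exact: openT|].
- exact: smooth_mulmxr.
- by move=> q _; rewrite act_val.
Qed.

(** The projection x / |x| is the identity to first order in tangential
    directions. *)
Lemma derive_unitv (p : sphere6 R) u : tangent p u -> 'D_u (@unitv R) (sval p) = u.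
Proof.
rewrite /tangent dot_vdot => pu; have p0 := sphere_neq0 p.
have -> : 'D_u (@unitv R) (sval p) = 'D_u (fun x => nu x *: x) (sval p).
  by apply: near_eq_derive; near do apply: unitvE; exact: near_neq0.
have d0 : derivable (fun x : V => nu x *: x) (sval p) u.
  apply/diff_derivable/radial_field_differentiable => //.
  exact: radial_field_nu.
apply: crd_inj => n n7; rewrite (derive_crd n d0).
have did : derivable (id : V -> V) (sval p) u by exact: derivable_id.
have dc : derivable (fun x : V => crd x n : R) (sval p) u.
  exact/diff_derivable/differentiable_crd.
have dn : derivable (@nu R) (sval p) u by exact/diff_derivable/differentiable_nu.
have -> : (fun x : V => crd (nu x *: x) n) = @nu R * (fun x => crd x n).
  by apply/funext => x; rewrite crdZ.
rewrite (deriveM dn dc) derive_nu // pu !mulr0 oppr0 scaler0 addr0.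
by rewrite -(derive_crd n did) derive_id /nu sphereP sqrtr1 invr1 scale1r.
Unshelve. all: by end_near. Qed.

Lemma tangent_map_act M p u : isometric M -> tangent p u ->
  tangent_map (act M) p u = u *m M.
Proof.
move=> iM pu; rewrite /tangent_map radial_ext_act // derive_mulmxr.
  by rewrite derive_unitv.
exact: (@iter_derive_unitv_differentiable R [::]) (sphere_neq0 p).
Qed.

Lemma isometric_inv M : isometric M -> M \in unitmx /\ isometric (invmx M).
Proof.
move=> iM; have MU : M \in unitmx.
  rewrite -row_free_unit -kermx_eq0; apply/eqP/row_matrixP => i; rewrite row0.
  apply/eqP; rewrite -dot_eq0 -iM.
  by rewrite (sub_kermxP (row_sub i _)) dot0l.
by split=> // u v; rewrite -iM !mulmxKV.
Qed.

Lemma act_Aut M : isometric M ->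
  (forall u v, vcross u v *m M = vcross (u *m M) (v *m M)) -> Aut_omega (act M).
Proof.
move=> iM XM; have [MU iN] := isometric_inv iM; split.
  exists (act (invmx M)); split.
  - by move=> p; apply: sphere_inj; rewrite !act_val // mulmxK.
  - by move=> p; apply: sphere_inj; rewrite !act_val // mulmxKV.
  - exact: act_smooth.
  - exact: act_smooth.
move=> p u v w pu pv pw; rewrite /pullback /omega !tangent_map_act //.
by rewrite !omega_vdot -XM iM.
Qed.

Lemma act1 M : (forall u, u *m M = u) -> act M = id.
Proof.
by move=> hM; apply/funext => p; rewrite /act hM unitv_sphere.
Qed.

Lemma frame_isometric a b c : basic_triple a b c -> isometric (frame_mx a b c).
Proof. by move=> /frame_G2[]. Qed.

(** A curve of basic triples gives a continuous curve in the diffeomorphism group,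
    so membership in the identity component is transported along it. *)
Lemma frame_component a b c : basic_triple a b c ->
  connected_component (@Aut_omega R) (id : sphere6 R -> sphere6 R)
    (act (frame_mx a b c)).
Proof.
pose Q a b c := connected_component (@Aut_omega R)
  (id : sphere6 R -> sphere6 R) (act (frame_mx a b c)).
apply: (@basic_triples_connected R Q); last first.
  rewrite /Q (act1 (@frame_mx_ev R)); apply: connected_component_refl.
  rewrite -(act1 (@frame_mx_ev R)).
  by have [h1 h2] := frame_G2 (basic_triple_ev R); apply: act_Aut.
move=> k l m [kc lc mc] h t Q0; apply: connected_component_trans Q0 _.
pose M s := frame_mx (k s) (l s) (m s).
have iM s : isometric (M s) by apply: frame_isometric.
have cM : continuous ((fun s => act (M s)) : R -> Cinfty_selfmap R).
  apply: act_continuous => // i j.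
  have E : (fun s => M s i j) = (fun s => crd (frame (k s) (l s) (m s))`_i j).
    by apply/funext => s; rewrite mxE -crdE.
  rewrite E; move: {E} (j : nat) => n.
  have kl := cross_curve kc lc; have km := cross_curve kc mc.
  have lm := cross_curve lc mc; have mkl := cross_curve mc kl.
  case: i => i /= _; case: i => [|[|[|[|[|[|[|i]]]]]]] /=.
  - exact: kc.
  - exact: lc.
  - exact: kl.
  - exact: mc.
  - exact: km.
  - exact: lm.
  - exact: mkl.
  - by rewrite nth_nil => s; rewrite crd0; exact: cvg_cst.
exists ((fun s => act (M s)) @` setT); last by exists t.
split.
- by exists 0.
- move=> _ [s _ <-]; have [h1 h2] := frame_G2 (h s); exact: act_Aut.
- apply: connected_continuous_connected; first exact/connected_intervalP.
  exact: continuous_subspaceT.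
Qed.

Lemma G2_action_component :
  @G2_action R `<=` connected_component (@Aut_omega R) (id : sphere6 R -> sphere6 R).
Proof.
move=> f [g /G2P[gX gD] fg]; have [bg gE] := G2_frame gX gD.
have -> : f = act (frame_mx (g (ev R 0)) (g (ev R 1)) (g (ev R 3))).
  apply/funext => p; apply: sphere_inj.
  by rewrite (act_val p (frame_isometric bg)) fg gE.
exact: frame_component.
Qed.

End G2Component.

(** * Symmetry of second derivatives *)

Section Calculus.
Variable R : realType.
Local Notation V := 'rV[R]_7.
Implicit Types (u v w x y z : V).

Lemma line_derive (f : V -> R) p v (s : R) : derivable f (s *: v + p) v ->
  is_derive s (1 : R) (fun s => f (s *: v + p)) ('D_v f (s *: v + p)).
Proof.
have E : (fun h : R => h^-1 *: (f ((h *: 1 + s) *: v + p) - f (s *: v + p))) =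
    (fun h : R => h^-1 *: (f (h *: v + (s *: v + p)) - f (s *: v + p))).
  by apply/funext => h; rewrite scalerDl addrA /GRing.scale /= mulr1.
by move=> df; apply: DeriveDef; rewrite /derivable /derive /= E.
Qed.

Lemma eq_derive0_line (f : V -> R) p v :
  (forall t : R, derivable f (t *: v + p) v /\ 'D_v f (t *: v + p) = 0) ->
  f (v + p) = f p.
Proof.
move=> h; have := @is_derive_0_is_cst R (fun s => f (s *: v + p)) 1 0.
rewrite scale1r scale0r add0r; apply => t.
by have [dt d0] := h t; have := line_derive dt; rewrite d0.
Qed.

Let secdiff (f : V -> R) x u v (h : R) :=
  f (h *: v + (h *: u + x)) - f (h *: u + x) - (f (h *: v + x) - f x).

Let secdiffP (f : V -> R) x u v (e : R) : 0 < e ->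
  (\forall y \near x, differentiable f y) -> differentiable ('D_v f) x ->
  exists2 d, 0 < d & forall h, 0 < h < d ->
    `|secdiff f x u v h - h ^+ 2 * 'D_u ('D_v f) x| <= e * h ^+ 2.
Proof.
move=> e0 df dg; set g := 'D_v f; pose K := `|u| + `|v| + 1.
have K0 : 0 < K by rewrite ltr_wpDl // addr_ge0.
have [_ gE] := (diff_locallyP _ _).1 dg.
have e0' : 0 < e / (2 * K) by rewrite divr_gt0 // mulr_gt0.
have /nbhs_ballP[r /= r0 rP] := (eqaddoP _ _ _ _).1 gE _ e0'.
have /nbhs_ballP[r' /= r'0 r'P] := df.
have in_ball w (a : R) : 0 < a -> `|w| < a -> ball (0 : V) a w.
  by move=> a0; rewrite -ball_normE /= sub0r normrN.
exists (Num.min (r / K) (r' / K)).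
  by rewrite lt_min !divr_gt0.
move=> h /andP[h0]; rewrite lt_min !ltr_pdivlMr // => /andP[hr hr'].
have bnd (a s : R) : 0 <= a <= h -> 0 <= s <= h ->
    `|s *: v + a *: u| <= h * K.
  move=> /andP[a0 ah] /andP[s0 sh]; apply: (le_trans (ler_normD _ _)).
  rewrite !normrZ !ger0_norm // /K.
  have := normr_ge0 u; have := normr_ge0 v; nra.
have dfa (a s : R) : 0 <= a <= h -> 0 <= s <= h ->
    derivable f (s *: v + (a *: u + x)) v.
  move=> ha hs; apply: diff_derivable; apply: r'P; rewrite -ball_normE /=.
  rewrite addrA opprD addrCA subrr addr0 normrN.
  exact: le_lt_trans (bnd a s ha hs) hr'.
have h00 : 0 <= h <= h by rewrite lexx ltW.
have h01 : 0 <= (0 : R) <= h by rewrite lexx ltW.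
pose phi (s : R) := f (s *: v + (h *: u + x)) - f (s *: v + (0 *: u + x)).
pose dphi (s : R) := g (s *: v + (h *: u + x)) - g (s *: v + (0 *: u + x)).
have dph s : 0 <= s <= h -> is_derive s (1 : R) phi (dphi s).
  move=> hs; have d1 := line_derive (dfa h s h00 hs).
  have d2 := line_derive (dfa 0 s h01 hs).
  exact: is_deriveB.
have [c] : exists2 c, c \in `[0, h] & phi h - phi 0 = dphi c * (h - 0).
  apply: MVT_segment; first exact: ltW.
    by move=> s; rewrite in_itv /= => /andP[s0 sh]; apply: dph; rewrite !ltW.
  apply: derivable_within_continuous => s; rewrite in_itv /= => hs.
  by have [] := dph s hs.
rewrite in_itv /= subr0 => hc phiE.
have SE : secdiff f x u v h = dphi c * h.
  rewrite -phiE /phi /secdiff !scale0r !add0r; ring.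
have gap (a s : R) : 0 <= a <= h -> 0 <= s <= h ->
    `|g (s *: v + (a *: u + x)) - g x - 'd g x (s *: v + a *: u)|
      <= e / (2 * K) * (h * K).
  move=> ha hs; have b := bnd a s ha hs.
  have := rP _ (in_ball _ _ r0 (le_lt_trans b hr)).
  rewrite /= !fctE /= addrA opprD addrA => le1; apply: (le_trans le1).
  by rewrite ler_wpM2l // ltW.
(* The linear part of g contributes h 'd g x u, since the terms in c v cancel. *)
have ceq : dphi c - h * 'D_u g x =
    (g (c *: v + (h *: u + x)) - g x - 'd g x (c *: v + h *: u))
    - (g (c *: v + (0 *: u + x)) - g x - 'd g x (c *: v + 0 *: u)).
  rewrite (deriveE _ dg) /dphi !linearD !linearZ /= /GRing.scale /=; ring.
rewrite SE (_ : _ - _ = h * (dphi c - h * 'D_u g x)); last by ring.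
rewrite normrM gtr0_norm // ceq.
have -> : e * h ^+ 2 = h * (e * h) by ring.
apply: ler_wpM2l; first exact: ltW.
apply: (le_trans (ler_normB _ _)).
have := gap _ _ h00 hc; have := gap _ _ h01 hc => g1 g2.
apply: (le_trans (lerD g2 g1)).
by rewrite (_ : _ + _ = e * h) //; field; rewrite gt_eqF.
Qed.

(** Schwarz's theorem in Young's form, where the first derivatives need only be
    differentiable at x.  The second difference of f along u and v is symmetric
    in u and v, and by the mean value theorem (secdiffP) its quotient by h^2 tends
    to either of the two mixed derivatives. *)
Lemma derive_sym (f : V -> R) x u v :
  (\forall y \near x, differentiable f y) ->
  differentiable ('D_u f) x -> differentiable ('D_v f) x ->
  'D_u ('D_v f) x = 'D_v ('D_u f) x.
Proof.
move=> df du dv; apply/eqP; rewrite -subr_eq0 -normr_le0; apply/ler_addgt0Pl => e e0.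
rewrite addr0.
have e2 : 0 < e / 2 by rewrite divr_gt0.
have [d d0 dP] := secdiffP u e2 df dv; have [d' d'0 d'P] := secdiffP v e2 df du.
pose h := Num.min d d' / 2.
have m0 : 0 < Num.min d d' by rewrite lt_min d0.
have h0 : 0 < h by rewrite divr_gt0.
have hm : h < Num.min d d' by rewrite /h ltr_pdivrMr // ltr_pMr // ltr1n.
have hd : 0 < h < d by rewrite h0 (lt_le_trans hm) // ge_min lexx.
have hd' : 0 < h < d' by rewrite h0 (lt_le_trans hm) // ge_min lexx orbT.
have sym : secdiff f x v u h = secdiff f x u v h.
  by rewrite /secdiff addrCA; ring.
have := dP h hd; have := d'P h hd'; rewrite sym.
move: (secdiff _ _ _ _ _) ('D_u _ x) ('D_v _ x) => S a b h1 h2.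
have hh : 0 < h ^+ 2 by rewrite exprn_gt0.
rewrite -(ler_pM2l hh) -[X in X * `|_|]gtr0_norm // -normrM.
rewrite (_ : _ * (a - b) = (S - h ^+ 2 * b) - (S - h ^+ 2 * a)); last by ring.
apply: (le_trans (ler_normB _ _)); apply: (le_trans (lerD h1 h2)).
by rewrite -mulrDl -splitr mulrC.
Qed.

End Calculus.

(** * Rules of differentiation for vector fields *)

Section VectorCalculus.
Variable R : realType.
Local Notation V := 'rV[R]_7.
Implicit Types (u v w x y z : V) (F G : V -> V) (k : V -> R).

Lemma differentiable_crdf F n x : differentiable F x ->
  differentiable (fun y => crd (F y) n : R) x.
Proof.
move=> dF; exact: (differentiable_comp dF (differentiable_crd n (F x))).
Qed.

Lemma derivable_crdf F n x v : derivable F x v ->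
  derivable (fun y => crd (F y) n : R) x v.
Proof. by move=> dF; exact: (derivable_mxP _ _ _).1. Qed.

Lemma derivable_row F x v : (forall n, derivable (fun y => crd (F y) n : R) x v) ->
  derivable F x v.
Proof.
move=> h; apply/derivable_mxP => i j; rewrite ord1.
have -> : (fun y => F y 0 j) = (fun y => crd (F y) j).
  by apply/funext => y; rewrite crdE.
exact: h.
Qed.

Lemma differentiable_scale k F x : differentiable k x -> differentiable F x ->
  differentiable (fun y => k y *: F y) x.
Proof.
move=> dk dF; apply: differentiable_row => n; under eq_fun do rewrite crdZ.
by apply: differentiableM => //; exact: differentiable_crdf.
Qed.

Lemma derive_scale k F x v : derivable k x v -> derivable F x v ->
  'D_v (fun y => k y *: F y) x = 'D_v k x *: F x + k x *: 'D_v F x.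
Proof.
move=> dk dF.
have E n : (fun y => crd (k y *: F y) n) = k * (fun y => crd (F y) n).
  by apply/funext => y; rewrite crdZ.
have dkF : derivable (fun y => k y *: F y) x v.
  apply: derivable_row => n; rewrite E.
  exact: (derivableM dk (@derivable_crdf F n x v dF)).
apply: crd_inj => n _; rewrite (derive_crd n dkF) E.
rewrite (deriveM dk (@derivable_crdf F n x v dF)) -(derive_crd n dF) crdD !crdZ.
by rewrite /GRing.scale /= addrC (mulrC (crd (F x) n)).
Qed.

Lemma derive_comp F G x v : differentiable F x -> differentiable G (F x) ->
  'D_v (fun y => G (F y)) x = 'D_('D_v F x) G (F x).
Proof.
move=> dF dG; have dc : differentiable (fun y => G (F y)) x.
  exact: differentiable_comp dF dG.
rewrite (deriveE _ dc) (deriveE _ dF) (deriveE _ dG).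
exact: (congr1 (fun h : V -> V => h v) (diff_comp dF dG)).
Qed.

Lemma derive_sum_ev F x v : differentiable F x ->
  'D_v F x = \sum_(i < 7) crd v i *: 'D_(ev R i) F x.
Proof.
move=> dF; rewrite (deriveE _ dF) {1}(rV_sum_crd v) linear_sum.
by apply: eq_bigr => i _; rewrite linearZ /= (deriveE _ dF).
Qed.

(** By the cyclic symmetry of the triple product, each coordinate of F × G is a
    scalar product of F with the image of G under a fixed linear map, which reduces
    the product rule to derive_vdot. *)
Lemma derive_cross F G x v : differentiable F x -> differentiable G x ->
  'D_v (fun y => vcross (F y) (G y)) x =
  vcross ('D_v F x) (G x) + vcross (F x) ('D_v G x).
Proof.
move=> dF dG.
pose M w : 'M[R]_7 := \matrix_(i < 7) vcross w (ev R i).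
have ME w y : vcross w y = y *m M w.
  rewrite mulmx_sum_row {1}(rV_sum_crd y).
  elim/big_ind2: _ => [|? p ? q h1 h2|i _].
  - by rewrite cross0r.
  - by rewrite crossDr h1 h2.
  by rewrite crossZr rowK crdE.
have dxl n : differentiable (fun y => vcross (G y) (ev R n)) x.
  have -> : (fun y => vcross (G y) (ev R n)) = (fun y => G y *m - M (ev R n)).
    by apply/funext => y; rewrite crossC ME mulmxN.
  exact: differentiable_comp dG (differentiable_mulmxr _ _).
have dx n : 'D_v (fun y => vcross (G y) (ev R n)) x = vcross ('D_v G x) (ev R n).
  have -> : (fun y => vcross (G y) (ev R n)) = (fun y => G y *m - M (ev R n)).
    by apply/funext => y; rewrite crossC ME mulmxN.
  by rewrite (derive_mulmxr _ _ dG) mulmxN -ME -crossC.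
have cE n y z : (n < 7)%N -> crd (vcross y z) n = vdot y (vcross z (ev R n)).
  move=> n7; rewrite dot_crossr.
  have -> : forall w, vdot w (ev R n) = crd w n => // w.
  rewrite vdot.unlock /dot (bigD1 (inord n)) //= big1 => [|i ni].
    by rewrite !mxE !eqxx mulr1 addr0.
  by rewrite !mxE (negbTE ni) andbF mulr0.
have E n : (n < 7)%N -> (fun y => crd (vcross (F y) (G y)) n) =
    (fun y => vdot (F y) (vcross (G y) (ev R n))).
  by move=> n7; apply/funext => y; rewrite cE.
have dd (n : nat) := @differentiable_vdot R _ _ _ x dF (dxl n).
have dFG : derivable (fun y => vcross (F y) (G y)) x v.
  apply/derivable_mxP => i j; rewrite ord1.
  have -> : (fun y => vcross (F y) (G y) 0 j) = (fun y => crd (vcross (F y) (G y)) j).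
    by apply/funext => y; rewrite crdE.
  by rewrite E //; exact: diff_derivable.
apply: crd_inj => n n7; rewrite (derive_crd n dFG) E //.
have dF' := @diff_derivable _ _ _ _ _ v dF.
have dG' := @diff_derivable _ _ _ _ _ v (dxl n).
by rewrite (derive_vdot dF' dG') dx crdD !cE.
Qed.

Lemma differentiable_crossf F G x : differentiable F x -> differentiable G x ->
  differentiable (fun y => vcross (F y) (G y)) x.
Proof.
move=> dF dG; apply: differentiable_row => n.
have -> : (fun y => crd (vcross (F y) (G y)) n) =
  \sum_(i < 7) \sum_(j < 7) (fun y => crd (F y) i * crd (G y) j * ceps R i j (inord n : 'I_7)).
  apply/funext => y; rewrite vcross.unlock /crd cross_icross mxE.
  rewrite fct_sumE; apply: eq_bigr => i _; rewrite fct_sumE.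
  by apply: eq_bigr => j _.
apply: differentiable_sum => i; apply: differentiable_sum => j.
apply: differentiableM; last exact: differentiable_cst.
by apply: differentiableM; exact: differentiable_crdf.
Qed.

End VectorCalculus.

(** * The homogeneous extension of a sphere map *)

Section Cone.
Variable R : realType.
Local Notation V := 'rV[R]_7.
Implicit Types (u v w x y z : V).

(** The Euclidean norm, written so that it visibly belongs to radial_alg. *)
Definition rho x : R := nu x * vdot x x.

Lemma rho_gt0 x : x != 0 -> 0 < rho x.
Proof. by move=> x0; rewrite mulr_gt0 ?nu_gt0 // dot_gt0. Qed.

Lemma rho2 x : rho x * rho x = vdot x x.
Proof.
have [->|x0] := eqVneq x 0; first by rewrite /rho dot0l !mulr0.
by rewrite /rho mulrACA mulrA nu2 // mul1r.
Qed.

Lemma rho_nu x : x != 0 -> rho x * nu x = 1.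
Proof. by move=> x0; rewrite /rho mulrAC nu2. Qed.

Lemma rho_unit x : vdot x x = 1 -> rho x = 1.
Proof. by move=> x1; rewrite /rho /nu x1 sqrtr1 invr1 mulr1. Qed.

Lemma rho_unitv x : x != 0 -> x = rho x *: unitv x.
Proof. by move=> x0; rewrite unitvE // scalerA rho_nu // scale1r. Qed.

Lemma nuZ (t : R) x : 0 < t -> nu (t *: x) = t^-1 * nu x.
Proof.
move=> t0; rewrite /nu dotZl dotZr mulrA -expr2 sqrtrM ?sqr_ge0 //.
by rewrite sqrtr_sqr gtr0_norm // invfM.
Qed.

Lemma rhoZ (t : R) x : 0 < t -> rho (t *: x) = t * rho x.
Proof.
move=> t0; rewrite /rho nuZ // dotZl dotZr; field.
by rewrite gt_eqF.
Qed.

Lemma projZ (t : R) x : 0 < t -> x != 0 -> sphere6_proj (t *: x) = sphere6_proj x.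
Proof.
move=> t0 x0; apply: sphere_inj; rewrite -!/(unitv _) !unitvE ?scaler_eq0 //.
  by rewrite nuZ // scalerA mulrAC mulVf ?gt_eqF // mul1r.
by rewrite negb_or x0 gt_eqF.
Qed.

Lemma radial_alg_rho : radial_alg rho.
Proof.
apply: Ralg_mul; first exact: Ralg_nu.
exact: radial_alg_vdot (@radial_field_id R) (@radial_field_id R).
Qed.

Variable f : sphere6 R -> sphere6 R.

(** The extension of f to R^7 that is homogeneous of degree 1.  Its derivative at
    a point p of the sphere extends the tangent map of f by p |-> f p. *)
Definition cone_ext x : V := rho x *: radial_ext f x.

Lemma cone_extZ (t : R) x : 0 < t -> x != 0 -> cone_ext (t *: x) = t *: cone_ext x.
Proof.
by move=> t0 x0; rewrite /cone_ext rhoZ // /radial_ext projZ // scalerA.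
Qed.

Lemma cone_ext_dot x : vdot (cone_ext x) (cone_ext x) = vdot x x.
Proof. by rewrite dotZl dotZr sphereP mulr1 rho2. Qed.

Lemma cone_ext_sphere p : cone_ext (sval p) = sval (f p).
Proof.
by rewrite /cone_ext rho_unit ?sphereP // scale1r /radial_ext unitv_sphere.
Qed.

Hypothesis sf : smooth f.

(** Near x the extension is |y| F(y / |y|) for a local smooth extension F of f,
    which gives a formula for its first derivatives in terms of differentiable
    functions. *)
Lemma cone_ext_C2 x : x != 0 ->
  differentiable cone_ext x /\ forall w, differentiable ('D_w cone_ext) x.
Proof.
move=> x0; have [U [F [[oU Up] sF FE]]] := sf (sphere6_proj x).
have du y : y != 0 -> differentiable (@unitv R) y.
  exact: (@iter_derive_unitv_differentiable R [::]).
have dr y : y != 0 -> differentiable rho y.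
  by apply: radial_alg_differentiable; exact: radial_alg_rho.
have nearU y : y != 0 -> U (unitv y) -> \forall z \near y, U (unitv z).
  move=> y0 Uy; apply: (differentiable_continuous (du y y0)).
  exact: open_nbhs_nbhs.
have local y : y != 0 -> U (unitv y) ->
    \forall z \near y, rho z *: F (unitv z) = cone_ext z.
  move=> y0 Uy; near=> z; congr (_ *: _).
  by rewrite /unitv FE //; near: z; exact: nearU.
have dF y : U y -> differentiable F y by move=> Uy; exact: (sF [::] y Uy).
have dFu y : y != 0 -> U (unitv y) -> differentiable (fun z => F (unitv z)) y.
  by move=> y0 Uy; exact: differentiable_comp (du y y0) (dF _ Uy).
split.
  apply: near_eq_differentiable (local x x0 Up) _.
  by apply: differentiable_scale; [exact: dr|exact: dFu].
move=> w; pose G y := 'D_w rho y *: F (unitv y) +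
  rho y *: \sum_(i < 7) crd ('D_w (@unitv R) y) i *: 'D_(ev R i) F (unitv y).
have GE y : y != 0 -> U (unitv y) -> G y = 'D_w cone_ext y.
  move=> y0 Uy; rewrite -(near_eq_derive w (local y y0 Uy)).
  have dr' := @diff_derivable _ _ _ _ _ w (dr y y0).
  have dFu' := @diff_derivable _ _ _ _ _ w (dFu y y0 Uy).
  rewrite (derive_scale dr' dFu') (derive_comp w (du y y0) (dF _ Uy)).
  by rewrite (derive_sum_ev _ (dF _ Uy)).
have dG : differentiable G x.
  apply: differentiableD.
    apply: differentiable_scale; last exact: dFu.
    have [g ag gE] := radial_alg_derive w radial_alg_rho.
    apply: near_eq_differentiable (radial_alg_differentiable ag x0).
    by near do rewrite gE //; exact: near_neq0.
  apply: differentiable_scale; first exact: dr.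
  rewrite (_ : (fun y => _) = \sum_(i < 7) (fun y =>
    crd ('D_w (@unitv R) y) i *: 'D_(ev R i) F (unitv y))); last first.
    by apply/funext => y; rewrite fct_sumE.
  apply: differentiable_sum => i; apply: differentiable_scale.
    apply: differentiable_crdf.
    exact: (@iter_derive_unitv_differentiable R [:: w]).
  have dFi : differentiable ('D_(ev R i) F) (unitv x) by exact: (sF [:: ev R i]).
  exact: differentiable_comp (du x x0) dFi.
apply: near_eq_differentiable dG; near=> y; apply: GE.
  by near: y; exact: near_neq0.
by near: y; exact: nearU.
Unshelve. all: by end_near. Qed.

End Cone.

(** * Rigidity of maps preserving omega *)

Section Rigidity.
Variable R : realType.
Local Notation V := 'rV[R]_7.
Implicit Types (u v w x y z : V).
Variable f : sphere6 R -> sphere6 R.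
Hypothesis sf : smooth f.
Hypothesis omf : form3_eq (pullback f (@omega R)) (@omega R).
Local Notation Phi := (cone_ext f).

Let dPhi x : x != 0 -> differentiable Phi x.
Proof. by move=> /(cone_ext_C2 sf)[]. Qed.

Let ddPhi x w : x != 0 -> differentiable ('D_w Phi) x.
Proof. by move=> /(cone_ext_C2 sf)[]. Qed.

Let dvPhi x v : x != 0 -> derivable Phi x v.
Proof. by move=> x0; exact: (diff_derivable (dPhi x0)). Qed.

Let AE x u : x != 0 -> 'D_u Phi x = 'd Phi x u.
Proof. by move=> x0; rewrite (deriveE _ (dPhi x0)). Qed.

Arguments dvPhi {x} v _.
Arguments ddPhi {x} w _.
Arguments AE {x} u _.

Lemma cone_deriveZ (t : R) x u : 0 < t -> x != 0 ->
  'D_u Phi (t *: x) = 'D_u Phi x.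
Proof.
move=> t0 x0; have tx0 : t *: x != 0 by rewrite scaler_eq0 negb_or gt_eqF.
have did : derivable (id : V -> V) x u by exact: derivable_id.
have dt : differentiable (fun y : V => t *: y) x.
  exact: (differentiableZ t (@ex_diff _ _ _ _ _ _ _ (is_diff_id x))).
have Dt : 'D_u (fun y : V => t *: y) x = t *: u.
  by rewrite (deriveZ t did) derive_id.
have := derive_comp u dt (dPhi tx0); rewrite Dt.
rewrite (near_eq_derive (g := t \*: Phi)); last first.
  near=> y; have y0 : y != 0 by near: y; exact: near_neq0.
  exact: (cone_extZ f t0 y0).
rewrite (deriveZ t (dvPhi u x0)) (AE _ tx0) linearZ -(AE u tx0).
by move=> /scalerI ->; rewrite ?gt_eqF.
Unshelve. all: by end_near. Qed.

Lemma cone_euler x : x != 0 -> 'D_x Phi x = Phi x.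
Proof.
move=> x0; apply: crd_inj => n _; rewrite (derive_crd n (dvPhi x x0)).
pose c := crd (Phi x) n.
have dl : derivable (fun y => crd (Phi y) n : R) (0 *: x + x) x.
  by rewrite scale0r add0r; exact: derivable_crdf (dvPhi x x0).
have [_] := line_derive dl; rewrite scale0r add0r => <-.
rewrite (near_eq_derive (g := id * cst c + cst c)); last first.
  near=> s; rewrite /= !fctE /=.
  have -> : s *: x + x = (s + 1) *: x by rewrite scalerDl scale1r.
  rewrite cone_extZ //; first by rewrite crdZ mulrDl mul1r.
  have : `|0 - s| < 1 by near: s; exact: (nbhsx_ballx (0 : R) 1).
  by rewrite sub0r normrN ltr_norml => /andP[]; lra.
have di : derivable (id : R -> R) (0 : R) 1 by exact: derivable_id.
have dc : derivable (cst c : R -> R) (0 : R) 1 by exact: derivable_cst.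
rewrite (deriveD (derivableM di dc) dc) (deriveM di dc) derive_id !derive_cst.
by rewrite /GRing.scale /= mul0r add0r mulr1 addr0.
Unshelve. all: by end_near. Qed.

Lemma cone_derive_dot x u : x != 0 -> vdot (Phi x) ('D_u Phi x) = vdot x u.
Proof.
move=> x0; have did : derivable (id : V -> V) x u by exact: derivable_id.
have := derive_vdot (dvPhi u x0) (dvPhi u x0).
rewrite (_ : (fun y => _) = (fun y => vdot y y)); last first.
  by apply/funext => y; rewrite cone_ext_dot.
by rewrite (derive_vdot did did) derive_id (vdotC u) (vdotC ('D_u _ x)); lra.
Qed.

Lemma cone_tangent_map (p : sphere6 R) u : vdot (sval p) u = 0 ->
  tangent_map f p u = 'D_u Phi (sval p).
Proof.
move=> pu; have p0 := sphere_neq0 p; rewrite /tangent_map.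
rewrite (near_eq_derive (g := fun y => nu y *: Phi y)); last first.
  near=> y; rewrite /cone_ext scalerA mulrC rho_nu ?scale1r //.
  by near: y; exact: near_neq0.
have dn : derivable (@nu R) (sval p) u by exact/diff_derivable/differentiable_nu.
rewrite (derive_scale dn (dvPhi u p0)) derive_nu // pu mulr0 oppr0 scale0r add0r.
by rewrite /nu sphereP sqrtr1 invr1 scale1r.
Unshelve. all: by end_near. Qed.

Lemma cone_omega (p : sphere6 R) u v w : vdot (sval p) u = 0 ->
  vdot (sval p) v = 0 -> vdot (sval p) w = 0 ->
  vdot (vcross ('D_u Phi (sval p)) ('D_v Phi (sval p))) ('D_w Phi (sval p)) =
  vdot (vcross u v) w.
Proof.
move=> pu pv pw; rewrite -!cone_tangent_map // -!omega_vdot.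
by apply: (@omf p); rewrite /tangent dot_vdot.
Qed.

Lemma cone_omega_map (p : sphere6 R) :
  tangent_omega_map ('d Phi (sval p)) (sval p) (Phi (sval p)).
Proof.
have p0 := sphere_neq0 p; split.
- exact: sphereP.
- by rewrite cone_ext_dot sphereP.
- by rewrite -AE // cone_euler.
- by move=> u pu; rewrite -AE // cone_derive_dot.
- by move=> u v w pu pv pw; rewrite -!AE // cone_omega.
Qed.

(** On the unit sphere this is omega_map_J; both sides scale in the same way along
    rays. *)
Lemma cone_J x : x != 0 -> exists2 s : R, s ^+ 2 = 1 &
  forall u, 'D_(vcross x u) Phi x = s *: vcross (Phi x) ('D_u Phi x).
Proof.
move=> x0; pose p := sphere6_proj x; have p0 := sphere_neq0 p.
have [s s2 sJ] := omega_map_J (cone_omega_map p).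
exists s => // u; have xE : x = rho x *: sval p by exact: rho_unitv.
have r0 := rho_gt0 x0.
have D1 w : 'D_w Phi x = 'D_w Phi (sval p) by rewrite {1}xE cone_deriveZ.
have P1 : Phi x = rho x *: Phi (sval p) by rewrite {1}xE cone_extZ.
have X1 : vcross x u = rho x *: vcross (sval p) u by rewrite {1}xE crossZl.
rewrite X1 !D1 P1 crossZl (AE (_ *: _) p0) linearZ sJ -(AE u p0).
by rewrite [LHS]scalerA [RHS]scalerA mulrC.
Qed.

(** Second derivatives of the extension: first along w, then along v. *)
Let B x v w := 'D_v ('D_w Phi) x.

(** The product rule for the pairing of a matrix field with a vector field,
    obtained by expanding F y in the standard basis. *)
Lemma second_derive_apply (F : V -> V) x v : x != 0 -> differentiable F x ->
  'D_v (fun y => 'D_(F y) Phi y) x =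
  B x v (F x) + 'D_('D_v F x) Phi x.
Proof.
pose G (F : V -> V) y := \sum_(i < 7) crd (F y) i *: 'D_(ev R i) Phi y.
have GE (F' : V -> V) y : y != 0 -> G F' y = 'D_(F' y) Phi y.
  by move=> y0; rewrite (derive_sum_ev _ (dPhi y0)).
have DG (F' : V -> V) y : y != 0 -> differentiable F' y ->
    'D_v (G F') y = \sum_(i < 7) crd (F' y) i *: B y v (ev R i)
      + 'D_('D_v F' y) Phi y.
  move=> y0 dF'; have dv' := @diff_derivable _ _ _ _ _ v dF'.
  have dc (i : 'I_7) : derivable (fun z => crd (F' z) i : R) y v.
    exact: derivable_crdf.
  have da (i : 'I_7) := @diff_derivable _ _ _ _ _ v (ddPhi (ev R i) y0).
  rewrite (_ : G F' = \sum_(i < 7) (fun z => crd (F' z) i *: 'D_(ev R i) Phi z));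
    last by apply/funext => z; rewrite fct_sumE.
  rewrite derive_sum; last first.
    move=> i; apply: diff_derivable; apply: differentiable_scale.
      exact: differentiable_crdf.
    exact: ddPhi.
  rewrite (derive_sum_ev _ (dPhi y0)) -big_split /=; apply: eq_bigr => i _.
  by rewrite (derive_scale (dc i) (da i)) (derive_crd i dv') addrC.
move=> x0 dF; rewrite (near_eq_derive (g := G F)); last first.
  by near=> y; rewrite GE //; near: y; exact: near_neq0.
rewrite DG //; congr (_ + _).
have dcst : differentiable (fun _ : V => F x) x by exact: differentiable_cst.
have := DG _ x x0 dcst; rewrite derive_cst AE // linear0 addr0 => <-.
by apply: near_eq_derive; near=> y; rewrite GE //; near: y; exact: near_neq0.
Unshelve. all: by end_near. Qed.

Lemma second_deriveN x v w : x != 0 -> B x v (- w) = - B x v w.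
Proof.
move=> x0; have dw := @diff_derivable _ _ _ _ _ v (ddPhi w x0).
rewrite -(deriveN dw); apply: near_eq_derive; near=> y.
have y0 : y != 0 by near: y; exact: near_neq0.
by rewrite !fctE /= !AE // linearN.
Unshelve. all: by end_near. Qed.

Lemma second_derive_sym x v w : x != 0 -> B x v w = B x w v.
Proof.
move=> x0; have dw u z := @diff_derivable _ _ _ _ _ z (ddPhi u x0).
have crdD u n : \forall y \near x, crd ('D_u Phi y) n =
    'D_u (fun z => crd (Phi z) n : R) y.
  near=> y; have y0 : y != 0 by near: y; exact: near_neq0.
  by rewrite (derive_crd n (dvPhi u y0)).
apply: crd_inj => n _.
have e1 := derive_crd n (dw w v).
have e2 := derive_crd n (dw v w).
have e3 := near_eq_derive v (crdD w n).
have e4 := near_eq_derive w (crdD v n).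
apply: (etrans (etrans e1 e3)); apply: (etrans _ (esym (etrans e2 e4))).
apply: derive_sym.
- near=> y; apply: differentiable_crdf; apply: dPhi.
  by near: y; exact: near_neq0.
- apply: near_eq_differentiable (crdD v n) _.
  by apply: differentiable_crdf; exact: ddPhi.
- apply: near_eq_differentiable (crdD w n) _.
  by apply: differentiable_crdf; exact: ddPhi.
Unshelve. all: by end_near. Qed.

Lemma derive_apply_differentiable (F : V -> V) x : x != 0 -> differentiable F x ->
  differentiable (fun y => 'D_(F y) Phi y) x.
Proof.
move=> x0 dF.
apply: (@near_eq_differentiable _ _ _
  (\sum_(i < 7) (fun y => crd (F y) i *: 'D_(ev R i) Phi y))).
  near=> y; have y0 : y != 0 by near: y; exact: near_neq0.
  by rewrite fct_sumE (derive_sum_ev (F y) (dPhi y0)).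
apply: differentiable_sum => i; apply: differentiable_scale.
  exact: differentiable_crdf.
exact: ddPhi.
Unshelve. all: by end_near. Qed.

Lemma cone_derive_inj (p : sphere6 R) u : 'D_u Phi (sval p) = 0 -> u = 0.
Proof.
by rewrite (AE u (sphere_neq0 p)); exact: (omega_map_inj (cone_omega_map p)).
Qed.

(** The sign s(x) of cone_J is the sign of a continuous function h which does not
    vanish at p, hence it is constant near p. *)
Lemma cone_J_near (p : sphere6 R) : exists2 s : R, s ^+ 2 = 1 &
  \forall x \near sval p, forall u,
    'D_(vcross x u) Phi x = s *: vcross (Phi x) ('D_u Phi x).
Proof.
have p0 := sphere_neq0 p; have [s s2 sJ] := cone_J p0; exists s => //.
have [u u1 /(_ (sval p))] := @exists_perp R [:: sval p] isT.
rewrite inE => /(_ (eqxx _)) pu.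
pose h x := vdot ('D_(vcross x u) Phi x) (vcross (Phi x) ('D_u Phi x)).
have dh : differentiable h (sval p).
  apply: differentiable_vdot.
    apply: derive_apply_differentiable => //; apply: differentiable_crossf.
      exact: (@ex_diff _ _ _ _ _ _ _ (is_diff_id (sval p))).
    exact: differentiable_cst.
  by apply: differentiable_crossf; [exact: dPhi|exact: ddPhi].
have hp : 0 < s * h (sval p).
  rewrite /h sJ dotZl mulrA -expr2 s2 mul1r dot_cross_cross cone_derive_dot //.
  rewrite pu mul0r subr0 cone_ext_dot sphereP mul1r dot_gt0.
  apply/eqP => /cone_derive_inj u0.
  by move: u1; rewrite u0 dot0l => /eqP; rewrite eq_sym oner_eq0.
have near_h : \forall x \near sval p, 0 < s * h x.
  have dsh : differentiable (fun x => s * h x) (sval p).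
    by apply: differentiableM => //; exact: differentiable_cst.
  have cs := differentiable_continuous dsh.
  exact: (cvgr_gt _ cs _ hp).
near=> x; have x0 : x != 0 by near: x; exact: near_neq0.
have hx : 0 < s * h x by near: x; exact: near_h.
have [s' s'2 s'J] := cone_J x0; suff -> : s = s' by [].
move: hx; rewrite /h s'J dotZl mulrA.
have := dot_ge0 (vcross (Phi x) ('D_u Phi x)); move: (vdot _ _) => m m0 hx.
have ss : 0 < s * s' by move: m0; rewrite le_eqVlt => /orP[/eqP m0|m0];
  [move: hx; rewrite -m0 mulr0 ltxx|rewrite -(pmulr_lgt0 _ m0)].
move/eqP: s2; rewrite sqrf_eq1 => /orP[]/eqP sE; move/eqP: s'2;
  rewrite sqrf_eq1 => /orP[]/eqP s'E; move: ss; rewrite sE s'E //; lra.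
Unshelve. all: by end_near. Qed.

Lemma cone_J_derive (p : sphere6 R) : exists s : R, [/\ s ^+ 2 = 1,
  forall u, 'D_(vcross (sval p) u) Phi (sval p) =
    s *: vcross (Phi (sval p)) ('D_u Phi (sval p)) &
  forall v u, B (sval p) v (vcross (sval p) u) + 'D_(vcross v u) Phi (sval p) =
    s *: (vcross ('D_v Phi (sval p)) ('D_u Phi (sval p)) +
          vcross (Phi (sval p)) (B (sval p) v u))].
Proof.
have p0 := sphere_neq0 p; have [s s2 sJ] := cone_J_near p; exists s; split=> //.
  exact: nbhs_singleton sJ.
move=> v u.
have did : differentiable (id : V -> V) (sval p).
  exact: (@ex_diff _ _ _ _ _ _ _ (is_diff_id (sval p))).
have dcu : differentiable (fun _ : V => u) (sval p) by exact: differentiable_cst.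
have dx := differentiable_crossf did dcu.
have e1 := second_derive_apply v p0 dx.
have e2 := derive_cross v did dcu.
have dPx := differentiable_crossf (dPhi p0) (ddPhi u p0).
have e3 := derive_cross v (dPhi p0) (ddPhi u p0).
have dP' := @diff_derivable _ _ _ _ _ v dPx.
have e4 := deriveZ s dP'.
rewrite derive_id derive_cst cross0r addr0 in e2.
rewrite -[X in 'D_X Phi _]e2 -e1 -e3; apply: (etrans _ e4).
apply: near_eq_derive; near=> x; exact: (near sJ x).
Unshelve. all: by end_near. Qed.

Lemma cone_rigid (p : sphere6 R) :
  (forall u v, vdot ('D_u Phi (sval p)) ('D_v Phi (sval p)) = vdot u v) /\
  (forall u, 'D_(vcross (sval p) u) Phi (sval p) =
     vcross (Phi (sval p)) ('D_u Phi (sval p))).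
Proof.
have p0 := sphere_neq0 p; have [s [s2 sJ sE]] := cone_J_derive p.
have [||||s1 iso] :=
  @nijenhuis_isometry R _ _ _ (B (sval p)) s (cone_omega_map p) s2.
- by move=> u; rewrite -!AE.
- by move=> u v; exact: second_derive_sym.
- by move=> u v; exact: second_deriveN.
- by move=> v u; rewrite -!AE.
split=> u; first by move=> v; rewrite !AE.
by rewrite sJ s1 scale1r.
Qed.

Lemma cone_isometry x u v : x != 0 ->
  vdot ('D_u Phi x) ('D_v Phi x) = vdot u v.
Proof.
move=> x0; have [iso _] := cone_rigid (sphere6_proj x).
have xE : x = rho x *: sval (sphere6_proj x) by exact: rho_unitv.
by rewrite xE !cone_deriveZ ?rho_gt0 ?sphere_neq0 // iso.
Qed.

Lemma second_derive0 x v u : x != 0 -> B x v u = 0.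
Proof.
move=> x0; apply: (@isometry_second_derivative0 R (fun u => 'D_u Phi x) (B x)).
- move=> w; have [|z zw] := @lin_inj_surj R ('d Phi x) _ w.
    move=> z; rewrite -AE // => z0; apply/eqP; rewrite -dot_eq0.
    by rewrite -(cone_isometry z z x0) z0 dot0l.
  by exists z; rewrite AE.
- by move=> a b; exact: second_derive_sym.
move=> a b c; have db := @diff_derivable _ _ _ _ _ a (ddPhi b x0).
have dc := @diff_derivable _ _ _ _ _ a (ddPhi c x0).
rewrite -(derive_vdot db dc) -(derive_cst (vdot b c) x a).
apply: near_eq_derive; near=> y; rewrite cone_isometry //.
by near: y; exact: near_neq0.
Unshelve. all: by end_near. Qed.

(** The second derivatives vanish by second_derive0, so the first derivatives are
    constant on every line that avoids the origin. *)
Lemma cone_derive_line x y u : (forall t : R, t *: y + x != 0) ->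
  'D_u Phi (y + x) = 'D_u Phi x.
Proof.
move=> h; apply: crd_inj => n _.
apply: (@eq_derive0_line R (fun z => crd ('D_u Phi z) n)) => t.
have du := @diff_derivable _ _ _ _ _ y (ddPhi u (h t)).
split; first exact: derivable_crdf.
rewrite -(derive_crd n du).
by have := second_derive0 y u (h t); rewrite /B => ->; rewrite crd0.
Qed.

(** Orthogonal nonzero vectors are joined by a line avoiding the origin, and any
    two vectors have a common nonzero orthogonal vector. *)
Lemma cone_derive_cst x y u : x != 0 -> y != 0 -> 'D_u Phi x = 'D_u Phi y.
Proof.
have indep a b : vdot a b = 0 -> a != 0 -> b != 0 -> 'D_u Phi b = 'D_u Phi a.
  move=> ab a0 b0; have -> : b = (b - a) + a by rewrite subrK.
  apply: cone_derive_line => t; apply/eqP => h.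
  have := congr1 (vdot a) h; rewrite dotDr dotZr dotBr ab dot0r.
  have := congr1 (vdot b) h; rewrite dotDr dotZr dotBr (vdotC b a) ab dot0r.
  rewrite subr0 addr0 => /eqP; rewrite mulf_eq0 dot_eq0 (negbTE b0) orbF => /eqP ->.
  by rewrite mul0r add0r => /eqP; rewrite dot_eq0 (negbTE a0).
move=> x0 y0; have [z z1 zP] := @exists_perp R [:: x; y] isT.
have z0 : z != 0 by rewrite -dot_eq0 z1 oner_eq0.
by rewrite -(indep x z) -?(indep y z) // zP // !inE eqxx ?orbT.
Qed.

(** The derivative of the extension is a constant linear map A, and Euler's
    relation identifies the extension with A. *)
Lemma Aut_omega_G2_action : G2_action f.
Proof.
have e0 := sphere_neq0 (sphere6_base R).
pose A : {linear V -> V} := 'd Phi (sval (sphere6_base R)).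
have AP x u : x != 0 -> 'D_u Phi x = A u.
  by move=> x0; rewrite -(AE u e0); exact: cone_derive_cst.
have APhi x : x != 0 -> Phi x = A x.
  by move=> x0; rewrite -(AP x x x0) cone_euler.
exists A; last by move=> p; rewrite -APhi ?sphere_neq0 // cone_ext_sphere.
apply/G2P; split=> u v; last by rewrite -!(AP _ _ e0) cone_isometry.
have [->|u0] := eqVneq u 0; first by rewrite linear0 !cross0l linear0.
have uE : u = rho u *: sval (sphere6_proj u) by exact: rho_unitv.
have p0 := sphere_neq0 (sphere6_proj u).
have [_ /(_ v)] := cone_rigid (sphere6_proj u); rewrite !AP // APhi //.
move: (rho u) (sval (sphere6_proj u)) uE => r q ->.
by rewrite crossZl !linearZ /= crossZl => ->.
Qed.

End Rigidity.

Theorem theorem3p10 (R : realType) :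
  connected_component (@Aut_omega R) (id : sphere6 R -> sphere6 R)
  = @G2_action R.
Proof.
apply/seteqP; split; last exact: G2_action_component.
move=> f /connected_component_sub[[g [_ _ sf _]] omf].
exact: Aut_omega_G2_action.
Qed.
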